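(* Let $d\ge1$, $t\ge1$ be integers, $\nu\in(0,1)$, and let $\mu_t$ be a finite Borel measure on $\mathbb S^d$ satisfying the upper Marcinkiewicz–Zygmund inequality of order $t$ with constant $A>0$, i.e. $\int_{\mathbb S^d}|f|^2\,d\mu_t\le A\|f\|_{L^2(\mathbb S^d)}^2$ for all $f\in\Pi_t$. Define $r>0$ by $r^2=(1-\nu)\frac{d+2}{t(t+d)}$. Then for all $x\in\mathbb S^d$, \[ \mu_t\big(B_r(x)\big)\le \frac{A}{\nu^2\,\dim\Pi_t}. \]
   Context: $\mathbb S^d=\{x\in\mathbb R^{d+1}:\|x\|=1\}$ carries the normalized surface measure $dy$ (total mass $1$); $\|f\|_{L^2(\mathbb S^d)}$ is taken with respect to it. For $x\in\mathbb S^d$ and $r\ge 0$, $B_r(x)=\{y\in\mathbb S^d: x\cdot y\ge\cos r\}$ is the closed spherical cap. $\Pi_t$ is the space of restrictions to $\mathbb S^d$ of (complex) polynomials in $d+1$ variables of total degree at most $t$; $\dim\Pi_t=\binom{d+t}{t}+\binom{d+t-1}{t-1}$. *)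

(* Defs.v *)
From HB Require Import structures.
From mathcomp Require Import all_boot all_order all_algebra.
From mathcomp Require Import all_classical all_reals all_analysis.
From mathcomp Require Import complex.


Unset Printing Implicit Defensive.
Import Order.TTheory GRing.Theory Num.Theory.
Import numFieldNormedType.Exports.
Local Open Scope classical_set_scope.
Local Open Scope ring_scope.

Section SphereDefs.
Variable R : realType.

(* Points of R^n are n-tuples of reals; n.-tuple R carries the product
   (= Borel) sigma-algebra of the library. *)

Definition dotp {n} (x y : n.-tuple R) : R := \sum_(i < n) tnth x i * tnth y i.

Definition sphere n : set (n.-tuple R) := [set x | dotp x x = 1].

Definition cap {n} (x : n.-tuple R) (r : R) : set (n.-tuple R) :=
  [set y | sphere n y /\ cos r <= dotp x y].

(* Lebesgue integral on R^n of a nonnegative function, as an iterated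
   integral against the one-dimensional Lebesgue measure (Tonelli). *)
Fixpoint leb_int {n : nat} : (n.-tuple R -> \bar R) -> \bar R :=
  match n return (n.-tuple R -> \bar R) -> \bar R with
  | 0 => fun g => g [tuple]
  | m.+1 => fun g =>
      (\int[@lebesgue_measure R]_x @leb_int m (fun u : m.-tuple R => g (cons_tuple x u)))%E
  end.

Definition unit_ball n : set (n.-tuple R) := [set x | dotp x x <= 1].

Definition radial {n} (x : n.-tuple R) : n.-tuple R :=
  map_tuple (fun c => c / Num.sqrt (dotp x x)) x.

Definition ball_volume n : R := fine (@leb_int n (fun x : n.-tuple R => (\1_(unit_ball n) x)%:E)).

(* Integral against the normalized surface measure of S^{n-1}: that measure
   is the image of the normalized Lebesgue measure of the unit ball under the
   radial projection (normalized cone measure = normalized surface measure). *)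
Definition sphere_int {n} (g : n.-tuple R -> \bar R) : \bar R :=
  (@leb_int n (fun x : n.-tuple R => (\1_(unit_ball n) x)%:E * g (radial x))
   * ((ball_volume n)^-1)%:E)%E.

(* Polynomials of total degree at most t in n variables with complex
   coefficients, written out in the monomial basis: the coefficient family
   c assigns to each exponent vector a (with entries <= t) a coefficient;
   only exponents with total degree sum_i a_i <= t are used.
   [peval t c x] = sum_{|a| <= t} c_a x^a, evaluated at a real point x. *)
Definition peval {n : nat} (t : nat)
  (c : {ffun 'I_n -> 'I_t.+1} -> complex.complex R) (x : n.-tuple R)
  : complex.complex R :=
  \sum_(a : {ffun 'I_n -> 'I_t.+1} | (\sum_(i < n) (a i : nat) <= t)%N)
     c a * \prod_(i < n) (complex.Complex (tnth x i) 0) ^+ a i.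

Definition sqmod {n : nat} (t : nat)
  (c : {ffun 'I_n -> 'I_t.+1} -> complex.complex R) (x : n.-tuple R) : R :=
  Normc.normc (peval t c x) ^+ 2.

Definition L2sq {n : nat} (t : nat)
  (c : {ffun 'I_n -> 'I_t.+1} -> complex.complex R) : \bar R :=
  sphere_int (fun x => (sqmod t c x)%:E).

End SphereDefs.

Definition dimPi (d t : nat) : nat := 'C(d + t, t) + 'C(d + t - 1, t - 1).

Arguments dotp {R n} x y.
Arguments cap {R n} x r.
Arguments radial {R n} x.
Arguments sphere_int {R n} g.
Arguments peval {R n} t c x.
Arguments sqmod {R n} t c x.
Arguments L2sq {R n} t c.

(* Main.v *)
Require Import Defs.
From HB Require Import structures.
From mathcomp Require Import all_boot all_order all_algebra.
From mathcomp Require Import all_classical all_reals all_analysis.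
From mathcomp Require Import complex.
From mathcomp Require Import measurable_realfun polyrcf.
From mathcomp Require Import ring lra zify.
Import Order.TTheory GRing.Theory Num.Theory.
Import numFieldNormedType.Exports.
Local Open Scope classical_set_scope.
Local Open Scope ring_scope.

(** The reproducing kernel of [Pi_t] at [x] is zonal, [y |-> dim Pi_t * p(1 - x.y)],
    with [p] the Jacobi polynomial 2F1(-t, t + d; d/2 + 1; u/2), [p(0) = 1].
    Testing the Marcinkiewicz-Zygmund inequality on [f(y) = p(1 - x.y)] gives the
    bound as soon as [||f||^2 = 1 / dim Pi_t] and [f >= nu] on the cap.

    The lower bound on the cap: a Sonin-type energy shows that [|p'|] is maximal at
    [u = 0] on [[0, 1]], so [p(u) >= 1 + p'(0) u] with [p'(0) = - t (t + d) / (d + 2)],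
    and [1 - cos r <= r^2 / 2].

    The norm: the functional [L(q)], the mean of [q(1 - x.y)] over the sphere, satisfies
    [L(u (2 - u) q') = d L((u - 1) q)].  Together with the differential equation of [p]
    this makes [p] orthogonal to [u, ..., u^t], hence [L(p^2) = L(p)], and the
    difference of two consecutive kernels satisfies Gegenbauer's equation, hence has
    zero mean, so that [dim Pi_t * L(p)] does not depend on [t].

    The functional equation amounts to the moments of [x.y] on the sphere.  They are
    quotients of Gaussian integrals of [(x.y)^k] and [|y|^k] over R^n, which are computed
    coordinate by coordinate in the iterated integral; passing from the ball to the
    Gaussian weight only uses that Lebesgue measure is homogeneous, and Tonelli. *)

(** * Jacobi polynomials *)

Section JacobiPolynomial.
Variable R : realFieldType.
Implicit Types (d t k : nat) (p q : {poly R}).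

(** The ratio of consecutive terms of 2F1(-t, t + d; d/2 + 1; u/2), with the halves cleared from the
    denominator. The factor [j - t] stops the series at degree [t]. *)
Fixpoint jacobi_coef d t k : R :=
  if k is j.+1 then
    (j%:R - t%:R) * (j%:R + t%:R + d%:R) / (j.+1%:R * (j%:R *+ 2 + d%:R + 2))
    * jacobi_coef d t j
  else 1.

Definition jacobi d t : {poly R} := \poly_(k < t.+1) jacobi_coef d t k.

Lemma jacobi_coefS d t k :
  k.+1%:R * (k%:R *+ 2 + d%:R + 2) * jacobi_coef d t k.+1 =
  (k%:R - t%:R) * (k%:R + t%:R + d%:R) * jacobi_coef d t k.
Proof.
have hk : (k.+1%:R != 0 :> R) by rewrite pnatr_eq0.
have hd : (k%:R *+ 2 + d%:R + 2 != 0 :> R).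
  by rewrite -mulrnA -!natrD pnatr_eq0 addn2.
by rewrite /= mulrA mulrCA mulfV ?mulf_neq0// mulr1.
Qed.

Lemma jacobi_coef_gt d t k : (t < k)%N -> jacobi_coef d t k = 0.
Proof.
elim: k => // k IH; rewrite ltnS leq_eqVlt => /predU1P[<-|/IH] /=.
  by rewrite subrr !mul0r.
by move=> ->; rewrite mulr0.
Qed.

Lemma coef_jacobi d t k : (jacobi d t)`_k = jacobi_coef d t k.
Proof.
by rewrite coef_poly ltnS; case: leqP => // h; rewrite jacobi_coef_gt.
Qed.

Lemma size_jacobi d t : (size (jacobi d t) <= t.+1)%N.
Proof. exact: size_poly. Qed.

Lemma jacobi0 d t : (jacobi d t).[0] = 1.
Proof. by rewrite horner_coef0 coef_jacobi. Qed.

(** The operator sends a monomial into two adjacent degrees only, so both differential equations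
    below become two-term recurrences between coefficients. *)
Lemma coef_hypergeometric p (a b c : R) k :
  ('X * (2%:P - 'X) * p^`()^`() + (a%:P - b *: 'X) * p^`() + c *: p)`_k =
  (k.+1)%:R * (k%:R *+ 2 + a) * p`_k.+1 - (k%:R * (k%:R - 1 + b) - c) * p`_k.
Proof.
have -> : 'X * (2%:P - 'X) * p^`()^`() + (a%:P - b *: 'X) * p^`() + c *: p =
  2 *: ('X * p^`()^`()) - 'X * ('X * p^`()^`()) + a *: p^`() - b *: ('X * p^`())
  + c *: p :> {poly R}.
  by rewrite -!mul_polyC; ring.
rewrite !(coefD, coefN, coefZ, coefXM, coef_deriv).
case: k => [|[|k]]; rewrite /= ?coef_deriv.
- by ring.
- by ring.
- by ring.
Qed.

Lemma jacobi_ode d t :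
  'X * (2%:P - 'X) * (jacobi d t)^`()^`()
  + ((d%:R + 2)%:P - (d%:R + 1) *: 'X) * (jacobi d t)^`()
  + (t%:R * (t%:R + d%:R)) *: jacobi d t = 0.
Proof.
apply/polyP => k; rewrite coef_hypergeometric !coef_jacobi coef0.
by rewrite [k%:R *+ 2 + _]addrA jacobi_coefS; ring.
Qed.

(** A quotient of Pochhammer symbols: passing from t to t + 1 multiplies (-t)_k by (t + 1) / (t + 1
    - k) and (t + d)_k by (t + d + k) / (t + d). The form without division also covers k = t + 1. *)
Lemma jacobi_coef_pred d t k :
  (t.+1%:R - k%:R) * (t%:R + d%:R) * jacobi_coef d t.+1 k =
  t.+1%:R * (t%:R + d%:R + k%:R) * jacobi_coef d t k.
Proof.
have [|tk] := leqP k t; last first.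
  rewrite (jacobi_coef_gt _ t)//; move: tk; rewrite leq_eqVlt => /predU1P[<-|tk].
    by rewrite subrr !(mulr0, mul0r).
  by rewrite jacobi_coef_gt// !mulr0.
elim: k => [|k IH] kt; first by rewrite /=; ring.
have {}IH := IH (ltnW kt).
have hk : (k.+1%:R * (k%:R *+ 2 + d%:R + 2) != 0 :> R).
  by rewrite -mulrnA -!natrD -natrM pnatr_eq0 addn2.
have ht : (t.+1%:R - k%:R != 0 :> R).
  by rewrite -natrB ?pnatr_eq0 ?subn_eq0 -?ltnNge; lia.
apply: (mulfI ht); apply: (mulfI hk).
transitivity (((t.+1)%:R - k.+1%:R) * (k%:R - t.+1%:R) * (k%:R + t.+1%:R + d%:R) *
   (((t.+1)%:R - k%:R) * (t%:R + d%:R) * jacobi_coef d t.+1 k)).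
  have H := jacobi_coefS d t.+1 k.
  transitivity (((t.+1)%:R - k%:R) * ((t.+1)%:R - k.+1%:R) * (t%:R + d%:R) *
     (k.+1%:R * (k%:R *+ 2 + d%:R + 2) * jacobi_coef d t.+1 k.+1)); first by ring.
  by rewrite H; ring.
rewrite IH.
transitivity (((t.+1)%:R - k%:R) * t.+1%:R * (t%:R + d%:R + k.+1%:R) *
     (k.+1%:R * (k%:R *+ 2 + d%:R + 2) * jacobi_coef d t k.+1)); last by ring.
by rewrite jacobi_coefS -!natr1; ring.
Qed.

(* Up to a factor, the difference of consecutive reproducing kernels is the
   Gegenbauer polynomial of degree [t.+1]. *)
Lemma jacobi_sub_ode d t (a b : R) : (0 < d)%N ->
  a * t.+1%:R * (d%:R + t%:R *+ 2) = b * (d%:R + t%:R) * (d%:R + t%:R *+ 2 + 2) ->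
  let q := a *: jacobi d t.+1 - b *: jacobi d t in
  'X * (2%:P - 'X) * q^`()^`() + (d%:R%:P - d%:R *: 'X) * q^`()
  + (t.+1%:R * (t%:R + d%:R)) *: q = 0.
Proof.
move=> d0 hab q; apply/polyP => k; rewrite coef_hypergeometric coef0.
rewrite !(coefB, coefZ) !coef_jacobi.
(* Above degree t, only k = t + 1 can carry a nonzero coefficient, and there k (k - 1 + d) equals
   the eigenvalue (t + 1)(t + d). *)
have [tk|kt] := ltnP t k.
  rewrite !(jacobi_coef_gt d t k)// !(jacobi_coef_gt d _ k.+1)//; last by lia.
  move: tk; rewrite leq_eqVlt => /predU1P[<-|tk].
    by ring.
  by rewrite jacobi_coef_gt//; ring.
have d0' : (0 < d%:R :> R) by rewrite ltr0n.
have t0 : (0 <= t%:R :> R) by rewrite ler0n.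
have k0 : (0 <= k%:R :> R) by rewrite ler0n.
have kt' : (k%:R <= t%:R :> R) by rewrite ler_nat.
have E1 := jacobi_coefS d t.+1 k.
have E2 := jacobi_coefS d t k.
have E3 := jacobi_coef_pred d t k.
move: E1 E2 E3.
move: (jacobi_coef d t.+1 k.+1) (jacobi_coef d t k.+1) (jacobi_coef d t k)
  (jacobi_coef d t.+1 k) => x1 x2 x3 x4 E1 E2 E3.
have n1 : ((k%:R + 1) * (k%:R *+ 2 + d%:R + 2) != 0 :> R).
  by rewrite gt_eqF// mulr_gt0//; lra.
have n2 : ((t%:R + 1 - k%:R) * (t%:R + d%:R) != 0 :> R).
  by rewrite gt_eqF// mulr_gt0//; lra.
have n3 : ((d%:R + t%:R) * (d%:R + t%:R *+ 2 + 2) != 0 :> R).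
  by rewrite gt_eqF// mulr_gt0//; lra.
(* Writing [b] through [a], and the other three coefficients through [x3], reduces the claim to an
   identity of rational functions. *)
have {hab} -> : b = a * t.+1%:R * (d%:R + t%:R *+ 2) /
    ((d%:R + t%:R) * (d%:R + t%:R *+ 2 + 2)).
  by rewrite hab -[X in X / _]mulrA mulfK.
have {}E1 : x1 = (k%:R - t.+1%:R) * (k%:R + t.+1%:R + d%:R) * x4 /
   ((k%:R + 1) * (k%:R *+ 2 + d%:R + 2)).
  by rewrite -E1 -natr1 mulrAC mulfV// mul1r.
have {}E2 : x2 = (k%:R - t%:R) * (k%:R + t%:R + d%:R) * x3 /
   ((k%:R + 1) * (k%:R *+ 2 + d%:R + 2)).
  by rewrite -E2 -natr1 mulrAC mulfV// mul1r.
have {}E3 : x4 = t.+1%:R * (t%:R + d%:R + k%:R) * x3 /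
   ((t%:R + 1 - k%:R) * (t%:R + d%:R)).
  by rewrite -E3 -natr1 mulrAC mulfV// mul1r.
rewrite E1 E2 E3 -!natr1.
move: n1 n2 n3; rewrite !mulf_eq0 !negb_or => /andP[? ?] /andP[? ?] /andP[? ?].
by field; rewrite ?[_ *+ 2]mulr_natl; do !(apply/andP; split) => //; rewrite gt_eqF//; lra.
Qed.

(** The product form of the dimension. For positive d it is 1 at t = 0, where the induction in
    [zonal_jacobi] starts; the sum of binomials with truncated subtraction gives 2 there. *)
Definition jacobi_dim d t : R := (d%:R + t%:R *+ 2) / d%:R * 'C(d + t - 1, t)%:R.

Lemma jacobi_dimE d t : (0 < d)%N -> (0 < t)%N ->
  jacobi_dim d t = ('C(d + t, t) + 'C(d + t - 1, t - 1))%:R.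
Proof.
case: d => // d; case: t => // t _ _; rewrite /jacobi_dim !subn1 /=.
have -> : (d + t.+1 = (d + t).+1)%N by rewrite addnS.
have E1 : ((d.+1%:R : R) * 'C(d + t.+1, t)%:R = t.+1%:R * 'C(d + t.+1, t.+1)%:R).
  have := mul_bin_left (d + t.+1) t; rewrite addnS subSn ?leq_addl// addnK => h.
  by rewrite -!natrM h.
rewrite addnS in E1.
have E2 : 'C(d.+1 + t.+1, t.+1) = ('C((d + t).+1, t.+1) + 'C((d + t).+1, t))%N.
  by rewrite addSn addnS binS.
rewrite E2; move: E1 {E2}; move: ('C(_, t.+1)) ('C(_, t)) => b1 b0 E1.
rewrite !natrD; apply: (@mulfI _ d.+1%:R); first by rewrite pnatr_eq0.
rewrite mulrA mulrCA mulfV ?pnatr_eq0// mulr1.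
by rewrite !mulrDr !mulrDl E1; ring.
Qed.

(** This is the relation between the weights [a] and [b] in [jacobi_sub_ode]: with the dimensions as
    weights, the difference of consecutive kernels obeys Gegenbauer's equation. *)
Lemma jacobi_dimS d t : (0 < d)%N ->
  jacobi_dim d t.+1 * t.+1%:R * (d%:R + t%:R *+ 2) =
  jacobi_dim d t * (d%:R + t%:R) * (d%:R + t%:R *+ 2 + 2).
Proof.
case: d => // d _; rewrite /jacobi_dim !subn1 /= addnS.
have E : ((d.+1%:R + t%:R) * 'C(d + t, t)%:R = t.+1%:R * 'C((d + t).+1, t.+1)%:R :> R).
  by rewrite -natrD -!natrM; congr _%:R; exact: mul_bin_diag (d + t).+1 t.
move: E; move: ('C(_, t.+1)) ('C(_, t)) => b1 b0 E.
transitivity ((d.+1%:R + t.+1%:R *+ 2) / d.+1%:R * (d.+1%:R + t%:R *+ 2) *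
   (t.+1%:R * b1%:R : R)); first by ring.
by rewrite -E; ring.
Qed.

Lemma jacobi_dim_gt0 d t : (0 < d)%N -> 0 < jacobi_dim d t.
Proof.
move=> d0; rewrite /jacobi_dim mulr_gt0 ?divr_gt0 ?ltr0n//.
  by rewrite ltr_wpDr ?mulrn_wge0 ?ltr0n.
by rewrite bin_gt0; lia.
Qed.

(** * Orthogonality and norm of the Jacobi polynomial from integration by parts *)

Section ZonalFunctional.
Variables (d : nat) (L : {poly R} -> R).
Hypothesis d_gt0 : (0 < d)%N.
Hypothesis L_linear : scalar L.
Hypothesis L_byparts : forall q,
  L ('X * (2%:P - 'X) * q^`()) = d%:R * L (('X - 1) * q).

HB.instance Definition _ := GRing.isLinear.Build _ _ _ _ L L_linear.

(** Integrate by parts with p' u^(k+1), where the differential equation removes p'', and with p u^k.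
    The moments of p' enter both results only through the combination [2 * y1 - y2], which is then
    eliminated. *)
Lemma zonal_jacobi_rec t k :
  (t%:R * (t%:R + d%:R) - k%:R * (k%:R + d%:R)) * L (jacobi d t * 'X^(k.+1)) =
  - (k%:R * (k%:R *+ 2 + d%:R)) * L (jacobi d t * 'X^k).
Proof.
set p := jacobi d t; set N := t%:R * _.
have ode : 'X * (2%:P - 'X) * p^`()^`() =
    - (((d%:R + 2)%:P - (d%:R + 1) *: 'X) * p^`()) - N *: p.
  by apply/eqP; rewrite -subr_eq0 -(jacobi_ode d t) -/p -/N; apply/eqP; ring.
have H1 := L_byparts (p^`() * 'X^(k.+1)).
have H2 := L_byparts (p * 'X^k).
have D2 : 'X * (p * 'X^k)^`() = p^`() * 'X^(k.+1) + k%:R *: (p * 'X^k).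
  rewrite derivM derivXn mulrDr [X in X + _]mulrCA -exprS; congr (_ + _).
  by case: (k) => [|j]; rewrite ?mulr0n ?mulr0 ?scale0r//= -scaler_nat exprS -!mul_polyC;
    ring.
have D1 : (p^`() * 'X^(k.+1))^`() = p^`()^`() * 'X^(k.+1) + k.+1%:R *: (p^`() * 'X^k).
  by rewrite derivM derivXn -scaler_nat scalerAr.
have E2 : 'X * (2%:P - 'X) * (p * 'X^k)^`() =
    2 *: (p^`() * 'X^(k.+1)) - p^`() * 'X^(k.+2) + k%:R *: (2 *: (p * 'X^k) - p * 'X^(k.+1)).
  rewrite mulrAC D2 -!mul_polyC !exprS; ring.
have E1 : 'X * (2%:P - 'X) * (p^`() * 'X^(k.+1))^`() =
    (- (d%:R + 2)) *: (p^`() * 'X^(k.+1)) + (d%:R + 1) *: (p^`() * 'X^(k.+2))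
    - N *: (p * 'X^(k.+1)) + k.+1%:R *: (2 *: (p^`() * 'X^(k.+1)) - p^`() * 'X^(k.+2)).
  rewrite D1 mulrDr mulrA ode -!mul_polyC !exprS rmorphN/=; ring.
have F2 : ('X - 1) * (p * 'X^k) = p * 'X^(k.+1) - p * 'X^k by rewrite exprS; ring.
have F1 : ('X - 1) * (p^`() * 'X^(k.+1)) = p^`() * 'X^(k.+2) - p^`() * 'X^(k.+1).
  by rewrite [in RHS]exprS; ring.
rewrite {}E1 {}F1 !(linearD, linearN, linearZ)/= in H1.
rewrite {}E2 {}F2 !(linearD, linearN, linearZ)/= in H2.
move: H1 H2; move: (L (p^`() * _)) (L (p^`() * _)) (L (p * _)) (L (p * _)) => y2 y1 c0 c1.
rewrite /GRing.scale/= => H1 H2.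
have -> : (N - k%:R * (k%:R + d%:R)) * c1 = N * c1 - k%:R * (k%:R + d%:R) * c1 by ring.
have -> : N * c1 = k%:R * (2 * y1 - y2).
  apply/eqP; rewrite -subr_eq0; move/eqP: H1; rewrite -subr_eq0 => /eqP H1.
  by rewrite -oppr0 -H1 -natr1; apply/eqP; ring.
have -> : 2 * y1 - y2 = d%:R * (c1 - c0) - k%:R * (2 * c0 - c1) by rewrite -H2; ring.
by ring.
Qed.

(** In the recurrence the left factor is nonzero for k < t, and the right factor vanishes at k = 0,
    which starts the induction. *)
Lemma zonal_jacobi_orth t k : (k < t)%N -> L (jacobi d t * 'X^(k.+1)) = 0.
Proof.
have nz k' : (k' < t)%N -> t%:R * (t%:R + d%:R) - k'%:R * (k'%:R + d%:R) != 0 :> R.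
  move=> kt; rewrite -!natrD -!natrM -natrB; last by nia.
  by rewrite pnatr_eq0 subn_eq0 -ltnNge; nia.
elim: k => [|k IH] kt; apply: (mulfI (nz _ kt)); rewrite zonal_jacobi_rec mulr0.
  by rewrite mul0r oppr0 mul0r.
by rewrite IH ?mulr0// ltnW.
Qed.

Lemma zonal_jacobi_reproduces t q : (size q <= t.+1)%N ->
  L (jacobi d t * q) = q.[0] * L (jacobi d t).
Proof.
move=> sq; rewrite (_ : q = \sum_(i < t.+1) q`_i *: 'X^i); last first.
  rewrite -poly_def; apply/polyP => i; rewrite coef_poly.
  by case: ltnP => // /(leq_trans sq) h; rewrite nth_default.
rewrite big_ord_recl/= expr0 mulrDr linearD/= -scalerAr mulr1 linearZ/=.
rewrite mulr_sumr linear_sum/= big1 ?addr0.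
  rewrite horner_coef0 coefD coefZ coef1 mulr1 coef_sum big1 ?addr0// => i _.
  by rewrite coefZ coefXn/= mulr0.
by move=> i _; rewrite -scalerAr linearZ/= zonal_jacobi_orth ?mulr0.
Qed.

(** The operator is in divergence form for [L]: integration by parts with q' makes the second-order
    term cancel the first-order one, and [c * L q = 0] remains. *)
Lemma zonal_gegenbauer0 (q : {poly R}) (c : R) : c != 0 ->
  'X * (2%:P - 'X) * q^`()^`() + (d%:R%:P - d%:R *: 'X) * q^`() + c *: q = 0 ->
  L q = 0.
Proof.
move=> c0 ode; apply: (mulfI c0); rewrite mulr0.
have E : (d%:R%:P - d%:R *: 'X) * q^`() = (- d%:R) *: (('X - 1) * q^`()).
  by rewrite -!mul_polyC rmorphN/=; ring.
move/(congr1 L): ode; rewrite E linear0 2!linearD/= !linearZ/= L_byparts => <-.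
by ring.
Qed.

Lemma zonal_jacobi t : jacobi_dim d t * L (jacobi d t) = L 1.
Proof.
elim: t => [|t <-].
  have -> : jacobi d 0 = 1.
    by apply/polyP => -[|k]; rewrite coef_jacobi coef1// jacobi_coef_gt.
  by rewrite /jacobi_dim bin0 mulr1 mul0rn addr0 divff ?mul1r// pnatr_eq0 -lt0n.
apply/eqP; rewrite -subr_eq0 -!linearZ/= -linearB/=; apply/eqP.
have /(_ d_gt0 (jacobi_dimS d t d_gt0)) := @jacobi_sub_ode d t (jacobi_dim d t.+1) (jacobi_dim d t).
apply: zonal_gegenbauer0; rewrite -natrD -natrM pnatr_eq0; lia.
Qed.

Lemma zonal_jacobi_sqr t : jacobi_dim d t * L (jacobi d t ^+ 2) = L 1.
Proof.
by rewrite expr2 zonal_jacobi_reproduces ?size_jacobi// jacobi0 mul1r zonal_jacobi.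
Qed.

End ZonalFunctional.
End JacobiPolynomial.

(** * Lower bound for the Jacobi polynomial near u = 0 *)

Section JacobiBound.
Variable R : rcfType.

Lemma jacobi_deriv_ode (d t : nat) : let q := (jacobi R d t)^`() in
  'X * (2%:P - 'X) * q^`()^`() + ((d%:R + 4)%:P - (d%:R + 3) *: 'X) * q^`()
  + (t%:R * (t%:R + d%:R) - d%:R - 1) *: q = 0.
Proof.
move=> q; have /(congr1 (@deriv R)) := jacobi_ode R d t; rewrite -/q deriv0 => <-.
rewrite !(derivD, derivM, derivN, derivZ, derivC, derivX) -/q -!mul_polyC.
rewrite !(rmorphD, rmorphN, rmorphM, rmorph_nat, rmorph1)/=. by ring.
Qed.

(* [N q^2 + u (2 - u) q'^2], with [q] the derivative of the Jacobi polynomial,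
   decreases on [0, 1]. *)
Lemma jacobi_deriv_bound (d t : nat) (u : R) : (0 < t)%N -> 0 <= u <= 1 ->
  `|(jacobi R d t)^`().[u]| <= `|(jacobi R d t)^`().[0]|.
Proof.
case: t => [//|[|t]] _ /andP[u0 u1].
  (* At t = 1 the constant N = (t - 1)(t + d + 1) of the energy is zero, but the derivative is
     constant. *)
  have -> : (jacobi R d 1)^`() = (jacobi_coef R d 1 1)%:P.
    apply/polyP => k; rewrite coef_deriv coefC coef_jacobi.
    by case: k => [|k]; rewrite ?mulr1n// jacobi_coef_gt ?mul0rn.
  by rewrite !hornerC.
set q := _^`(); set N : R := t.+2%:R * (t.+2%:R + d%:R) - d%:R - 1.
have N0 : 0 < N.
  have : 0 <= d%:R :> R by []. have : 0 <= t%:R :> R by [].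
  by rewrite /N -!natr1; nra.
pose F := N *: q ^+ 2 + 'X * (2%:P - 'X) * q^`() ^+ 2.
have F' : F^`() = - (2 *: ((d%:R + 3)%:P - (d%:R + 2) *: 'X)) * q^`() ^+ 2.
  have := jacobi_deriv_ode d t.+2; rewrite -/q -/N => ode.
  apply/eqP; rewrite -subr_eq0; apply/eqP.
  (* The difference of the two sides is 2 q' times the left side of the differential equation, which
     is put in place of 0. *)
  transitivity (2 *: q^`() * 0); last by rewrite mulr0.
  rewrite -[X in _ = _ * X]ode /F.
  rewrite !(derivD, derivM, derivN, derivZ, derivC, derivX, expr2) -!mul_polyC.
  by rewrite !(rmorphD, rmorphN, rmorphM, rmorph_nat, rmorph1)/=; ring.
have : (- F).[0] <= (- F).[u].
  apply: (@ler_hornerW _ 0 1) => //; rewrite ?in_itv/= ?lexx ?ler01 ?u0//.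
  move=> x; rewrite in_itv/= => /andP[x0 x1].
  rewrite derivN F' mulNr opprK !(hornerM, hornerZ, hornerD, hornerN, hornerC, hornerX, horner_exp).
  by rewrite mulr_ge0 ?sqr_ge0// mulr_ge0//; have : 0 <= d%:R :> R by []; nra.
rewrite !(hornerM, hornerZ, hornerD, hornerN, hornerC, hornerX, horner_exp).
rewrite lerN2 !(mul0r, addr0) => FF.
have : N * q.[u] ^+ 2 <= N * q.[0] ^+ 2.
  by apply: le_trans FF; rewrite lerDl mulr_ge0 ?sqr_ge0// mulr_ge0//; lra.
rewrite ler_pM2l// -[X in X <= _]real_normK ?num_real//.
by rewrite -[X in _ <= X]real_normK ?num_real// ler_pXn2r ?nnegrE ?normr_ge0.
Qed.

Lemma jacobi_lower_bound (d t : nat) (u : R) : (0 < t)%N -> 0 <= u <= 1 ->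
  1 - u * (t%:R * (t%:R + d%:R) / (d%:R + 2)) <= (jacobi R d t).[u].
Proof.
move=> t0 /andP[u0 u1]; set c := _ / _.
have c0 : 0 <= c by rewrite divr_ge0// ?mulr_ge0// ?addr_ge0.
have q0 : (jacobi R d t)^`().[0] = - c.
  rewrite horner_coef0 coef_deriv mulr1n coef_jacobi /= /c mul0rn; field.
  by rewrite gt_eqF// ltr_wpDl.
have : (jacobi R d t + c *: 'X).[0] <= (jacobi R d t + c *: 'X).[u].
  apply: (@ler_hornerW _ 0 1) => //; rewrite ?in_itv/= ?lexx ?ler01 ?u0//.
  move=> x; rewrite in_itv/= => /andP[x0 x1].
  have := @jacobi_deriv_bound d t x t0; rewrite (ltW x0) (ltW x1) => /(_ isT).
  rewrite q0 normrN (ger0_norm c0) ler_norml => /andP[+ _].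
  by rewrite derivD derivZ derivX !(hornerD, hornerZ, hornerC) mulr1; lra.
by rewrite !(hornerD, hornerZ, hornerX) jacobi0; lra.
Qed.

End JacobiBound.

(** * One-dimensional Gaussian integrals *)

Section GaussianMoments.
Variable R : realType.
Implicit Types (q : {poly R}) (x y : R).
Local Notation mu := (@lebesgue_measure R).

Lemma gauss_fun_normal x : gauss_fun x = normal_fun 0 1 x * normal_fun 0 1 x.
Proof.
rewrite /gauss_fun /normal_fun subr0 expr1n -expRD; congr expR.
by rewrite -mulrDl; field.
Qed.

Lemma normal_fun_le1 x : normal_fun 0 1 x <= 1.
Proof.
rewrite /normal_fun subr0 -[leRHS]expR0 ler_expR mulNr oppr_le0.
by rewrite mulr_ge0 ?sqr_ge0// invr_ge0 mulrn_wge0// sqr_ge0.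
Qed.

(** The Gaussian is the square of [normal_fun 0 1]: one factor absorbs the power of |x|, and the
    other remains as an integrable majorant. *)
Lemma monomial_gauss_le k : exists C : R,
  forall x, `|x| ^+ k * gauss_fun x <= C * normal_fun 0 1 x.
Proof.
exists (2 ^+ k * (k`!)%:R) => x.
rewrite gauss_fun_normal mulrA ler_pM2r ?expR_gt0//.
rewrite /normal_fun subr0 expr1n mulNr expRN ler_pdivrMr ?expR_gt0//.
set y := x ^+ 2 / _; have y0 : 0 <= y by rewrite divr_ge0 ?sqr_ge0.
case: k => [|k]; first by rewrite !expr0 fact0 !mul1r -expR0 ler_expR.
(* Since 2 y = x^2, this is a <= 1 + a^2 for a = |x|^(k+1); the powers of y are then bounded by the
   exponential series. *)
apply: (@le_trans _ _ (1 + (2 * y) ^+ k.+1)).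
  have -> : 2 * y = `|x| ^+ 2 by rewrite /y real_normK ?num_real//; field.
  rewrite exprAC; have : 0 <= `|x| ^+ k.+1 by rewrite exprn_ge0.
  by nra.
have := expR_ge1Dxn k y0; rewrite -(ler_pM2l (x := 2 ^+ k.+1 * (k.+1)`!%:R)); last first.
  by rewrite mulr_gt0 ?exprn_gt0// ltr0n fact_gt0.
apply: le_trans; rewrite mulrDr mulr1 exprMn lerD//.
  by rewrite -natrX -natrM ler1n muln_gt0 expn_gt0 fact_gt0.
by rewrite -mulrA [X in _ <= _ * X]mulrC divfK// pnatr_eq0 -lt0n fact_gt0.
Qed.

Lemma poly_gauss_le q : exists C : R,
  forall x, `|q.[x] * gauss_fun x| <= C * normal_fun 0 1 x.
Proof.
rewrite -[q]coefK poly_def.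
elim: (size q) => [|n [C IH]].
  by exists 0 => x; rewrite big_ord0 horner0 !mul0r normr0.
have [D HD] := monomial_gauss_le n.
exists (C + `|q`_n| * D) => x.
rewrite big_ord_recr/= hornerD !mulrDl (le_trans (ler_normD _ _))// lerD//.
rewrite hornerZ hornerXn -!mulrA normrM ler_wpM2l//.
by rewrite normrM normrX [`|gauss_fun x|]ger0_norm ?gauss_fun_ge0.
Qed.

Lemma measurable_poly_gauss q :
  measurable_fun [set: measurableTypeR R] (fun x => q.[x] * gauss_fun x).
Proof.
apply: measurable_funM; last exact (@measurable_gauss_fun R).
exact (continuous_measurable_fun (@continuous_horner _ q)).
Qed.

Lemma integrable_poly_gauss q :
  mu.-integrable setT (EFin \o (fun x => q.[x] * gauss_fun x)).
Proof.
have [C HC] := poly_gauss_le q.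
have i1 : mu.-integrable setT (fun x => (normal_pdf 0 1 x)%:E) := integrable_normal_pdf 0 1.
apply: le_integrable (integrableZl measurableT (C / normal_peak 1) i1) => //.
  by apply/measurable_EFinP; exact (measurable_poly_gauss _).
move=> x _; rewrite normal_pdfE// lee_fin/=.
have p0 : normal_peak 1 != 0 :> R by rewrite gt_eqF// normal_peak_gt0.
by rewrite mulrA divfK// (le_trans (HC x))// ler_norm.
Qed.

Definition gauss_int q : R := (\int[mu]_x (q.[x] * gauss_fun x))%R.

Lemma gauss_intE q :
  (\int[mu]_x (q.[x] * gauss_fun x)%:E)%E = (gauss_int q)%:E.
Proof.
rewrite /gauss_int /Rintegral fineK//; apply: integrable_fin_num => //.
exact: integrable_poly_gauss.
Qed.

Lemma gauss_int_linear : scalar gauss_int.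
Proof.
move=> a p q; rewrite /gauss_int -RintegralZl//; last exact: integrable_poly_gauss.
rewrite -RintegralD//; last 2 first.
  have := integrableZl measurableT a (integrable_poly_gauss p).
  by apply: eq_integrable => // x _.
  exact: integrable_poly_gauss.
by apply: eq_Rintegral => x _; rewrite hornerD hornerZ mulrDl mulrA.
Qed.

HB.instance Definition _ := GRing.isLinear.Build _ _ _ _ gauss_int gauss_int_linear.

Lemma gauss_int1 : gauss_int 1 = Num.sqrt pi.
Proof.
apply: EFin_inj; rewrite -gauss_intE -integralT_gauss.
by apply: eq_integral => x _; rewrite hornerC mul1r.
Qed.

Lemma is_derive_poly_gauss q x :
  is_derive x 1 (fun y => q.[y] * gauss_fun y)
    ((q^`() - 2 *: ('X * q)).[x] * gauss_fun x).
Proof.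
have d1 : is_derive x 1 (@gauss_fun R) (gauss_fun x * (- x *+ 2)).
  rewrite /gauss_fun.
  apply: (@is_derive1_comp _ expR (fun y => - y ^+ 2)).
  by apply: trigger_derive; rewrite /= /GRing.scale/=; ring.
have := is_deriveM (is_derive_poly q x) d1.
move=> h; apply: is_derive_eq h _.
rewrite !(hornerD, hornerN, hornerZ, hornerM, hornerX) /GRing.scale/=.
by ring.
Qed.

(** The integrand is the derivative of q times the Gaussian. On growing symmetric intervals the
    integrals converge by dominated convergence, while the fundamental theorem turns them into
    boundary terms. These are O(1/n), because x q(x) times the Gaussian is bounded. *)
Lemma gauss_int_deriv q : gauss_int (q^`() - 2 *: ('X * q)) = 0.
Proof.
set f := q^`() - _.
pose F x := q.[x] * gauss_fun x.
pose I n := `[- n.+1%:R, n.+1%:R]%classic : set R.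
have mI n : measurable (I n) by exact: measurable_itv.
have HF n : (\int[mu]_(x in I n) (f.[x] * gauss_fun x)%:E)%E =
   (F n.+1%:R - F (- n.+1%:R))%:E.
  have dF (x : R) : derivable F x 1 by have [] := is_derive_poly_gauss q x.
  have cF : continuous F.
    by move=> x; apply/differentiable_continuous/derivable1_diffP.
  rewrite (@continuous_FTC2 _ _ F)//.
  - by have : 0 < n.+1%:R :> R by []; lra.
  - apply: continuous_subspaceT => x; apply: cvgM; first exact: continuous_horner.
    exact: continuous_gauss_fun.
  - split; first by move=> x _.
      by apply: cvg_at_right_filter; exact: cF.
    by apply: cvg_at_left_filter; exact: cF.
  - by move=> x _; rewrite derive1E; have [_ ->] := is_derive_poly_gauss q x.
pose f_ n x := ((f.[x] * gauss_fun x) * \1_(I n) x)%:E.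
have f_f x : f_ ^~ x @ \oo --> (f.[x] * gauss_fun x)%:E.
  apply: cvg_near_cst; near=> n.
  rewrite /f_ indicE mem_set ?mulr1// /I/= in_itv/= -ler_norml.
  near: n; exists (Num.truncn `|x|) => // n /= xn.
  by rewrite (le_trans (ltW (truncnS_gt _)))// ler_nat ltnS.
have f_le x n : (`|f_ n x| <= `|(f.[x] * gauss_fun x)%:E|)%E.
  rewrite /f_ lee_fin normrM ler_piMr//.
  by rewrite indicE; case: (_ \in _); rewrite ?normr1 ?normr0.
have mf : measurable_fun [set: measurableTypeR R] (fun x => (f.[x] * gauss_fun x)%:E).
  by apply/measurable_EFinP; exact (measurable_poly_gauss _).
have mf_ n : measurable_fun [set: measurableTypeR R] (f_ n).
  apply/measurable_EFinP; apply: measurable_funM; first exact (measurable_poly_gauss _).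
  by apply: measurable_indic; exact (mI n).
have [_ _] := @dominated_convergence _ (measurableTypeR R) _ mu _ measurableT _ _ _ mf_ mf
  (aeW mu (fun x _ => f_f x))
  (integrable_abse (integrable_poly_gauss f)) (aeW mu (fun x n _ => f_le x n)).
rewrite gauss_intE => /fine_cvg/= cvf.
have [C HC] := poly_gauss_le ('X * q).
have FC x : `|x| * `|F x| <= C.
  rewrite -normrM (_ : x * F x = ('X * q).[x] * gauss_fun x); last first.
    by rewrite hornerM hornerX mulrA.
  rewrite (le_trans (HC x))// ler_piMr ?normal_fun_le1//.
  by rewrite -(pmulr_lge0 _ (expR_gt0 _ : 0 < normal_fun 0 1 x)) (le_trans _ (HC x)).
have cv0 : (fun n => fine (\int[mu]_x f_ n x)) @ \oo --> (0 : R).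
  have -> : (fun n => fine (\int[mu]_x f_ n x)) =
      (fun n => F n.+1%:R - F (- n.+1%:R)).
    apply/funext => n; rewrite (_ : (\int[mu]_x f_ n x)%E = (F n.+1%:R - F (- n.+1%:R))%:E)//.
    rewrite -HF [RHS]integral_mkcond; apply: eq_integral => x _.
    by rewrite /f_ patchE indicE; case: ifPn => _; rewrite ?mulr1 ?mulr0.
  apply/norm_cvg0P.
  apply: (squeeze_cvgr (f := cst 0) (h := fun n => (C *+ 2) * (n.+1%:R)^-1)).
  - near=> n; rewrite normr_ge0/=.
    rewrite ler_pdivlMr ?ltr0n// mulrC (le_trans (ler_wpM2l _ (ler_normB _ _)))//.
    rewrite mulrDr mulr2n lerD//.
      by have := FC n.+1%:R; rewrite normr_nat.
    by have := FC (- n.+1%:R); rewrite normrN normr_nat.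
  - exact: cvg_cst.
  - rewrite -[X in _ --> X](mulr0 (C *+ 2)); apply: cvgM; first exact: cvg_cst.
    exact: cvg_harmonic.
exact: (cvg_unique _ cvf cv0).
Unshelve. all: by end_near. Qed.

(** Stein's identity for the Gaussian law of variance 1/2. *)
Lemma gauss_intXM q : gauss_int ('X * q) = 2^-1 * gauss_int q^`().
Proof.
have := gauss_int_deriv q; rewrite linearB/= linearZ/= => /eqP.
by rewrite subr_eq0 => /eqP ->; rewrite mulKf.
Qed.

(** * Moment polynomials of Gaussian and Gamma laws *)

Let deriv_one : (1 : {poly R})^`() = 0.
Proof. by rewrite -polyC1 derivC. Qed.

(* The polynomials [E (a + G) ^+ k] in [a], for [G] centred Gaussian of variance [s]. *)
Fixpoint hermite_pair (s : R) k : {poly R} * {poly R} :=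
  if k is j.+1 then
    let: (p, q) := hermite_pair s j in
    ('X * p + (s * j%:R) *: q, p)
  else (1, 0).

Definition hermite s k := (hermite_pair s k).1.

Lemma hermiteSS s k :
  hermite s k.+2 = 'X * hermite s k.+1 + (s * k.+1%:R) *: hermite s k.
Proof. by rewrite /hermite /=; case: hermite_pair. Qed.

Lemma hermite0 s : hermite s 0 = 1. Proof. by []. Qed.

Lemma hermite1 s : hermite s 1 = 'X.
Proof. by rewrite /hermite/= mulr1 mulr0 scale0r addr0. Qed.

Lemma deriv_hermite s k : (hermite s k.+1)^`() = k.+1%:R *: hermite s k.
Proof.
elim/ltn_ind: k => -[|[|k]] IH.
- by rewrite hermite1 hermite0 derivX scale1r.
- rewrite hermiteSS hermite1 hermite0 derivD derivZ derivM !derivX deriv_one.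
  by rewrite mulr1 mul1r scaler0 addr0 -mulr2n scaler_nat.
- rewrite hermiteSS derivD derivZ derivM derivX !IH//.
  rewrite !(hermiteSS s k) -!mul_polyC !rmorphM/= !rmorph_nat.
  by ring.
Qed.

(** Under the weight, v x is Gaussian of variance v^2 / 2, and variances of independent Gaussians
    add. Algebraically, Stein's identity makes the left side satisfy the Hermite recurrence with the
    enlarged variance. *)
Lemma gauss_int_affine s k (a v : R) :
  gauss_int (hermite s k \Po (a%:P + v *: 'X)) =
  Num.sqrt pi * (hermite (s + v ^+ 2 / 2) k).[a].
Proof.
set l := a%:P + _; set s' := s + _.
have step q : gauss_int (('X * q) \Po l) =
    a * gauss_int (q \Po l) + v ^+ 2 / 2 * gauss_int (q^`() \Po l).
  rewrite comp_polyM comp_polyX mulrDl mul_polyC linearD/= linearZ/=.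
  rewrite -scalerAl linearZ/= gauss_intXM deriv_comp.
  rewrite [in l^`()]/l !(derivD, derivC, derivZ, derivX) add0r.
  rewrite (_ : _ * v%:A = v *: (q^`() \Po l)); last by rewrite -scalerAr mulr1.
  rewrite linearZ/=.
  by ring.
elim/ltn_ind: k => -[|[|k]] IH.
- by rewrite !hermite0 comp_polyC gauss_int1 hornerC mulr1.
- rewrite !hermite1 hornerX -['X in LHS]mulr1 step deriv_one comp_poly0 linear0.
  by rewrite comp_polyC gauss_int1 mulr0 addr0 mulrC.
- rewrite hermiteSS comp_polyD comp_polyZ linearD/= linearZ/= step deriv_hermite.
  rewrite comp_polyZ linearZ/= !IH//.
  rewrite [in RHS]hermiteSS hornerD hornerM hornerZ hornerX /s'.
  by ring.
Qed.

Lemma hermite_even_rec s k :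
  (hermite s k.+2).[0] = s * k.+1%:R * (hermite s k).[0].
Proof. by rewrite hermiteSS hornerD hornerM hornerX mul0r add0r hornerZ. Qed.

(* The polynomials [E (a + G) ^+ k] in [a], for [G] of Gamma law with parameter [b]. *)
Fixpoint laguerre_pair (b : R) k : {poly R} * {poly R} :=
  if k is j.+1 then
    let: (p, q) := laguerre_pair b j in
    (('X + (b + j%:R)%:P) * p - j%:R *: ('X * q), p)
  else (1, 0).

Definition laguerre b k := (laguerre_pair b k).1.

Lemma laguerreSS b k : laguerre b k.+2 =
  ('X + (b + k.+1%:R)%:P) * laguerre b k.+1 - k.+1%:R *: ('X * laguerre b k).
Proof. by rewrite /laguerre /=; case: laguerre_pair. Qed.

Lemma laguerre0 b : laguerre b 0 = 1. Proof. by []. Qed.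

Lemma laguerre1 b : laguerre b 1 = 'X + b%:P.
Proof. by rewrite /laguerre/= addr0 mulr1 mulr0 scaler0 subr0. Qed.

Lemma deriv_laguerre b k : (laguerre b k.+1)^`() = k.+1%:R *: laguerre b k.
Proof.
elim/ltn_ind: k => -[|[|k]] IH.
- by rewrite laguerre1 laguerre0 derivD derivX derivC addr0 scale1r.
- rewrite laguerreSS laguerre1 laguerre0 !(derivD, derivN, derivZ, derivM, derivX, derivC).
  by rewrite -!mul_polyC !rmorphD/= !rmorph_nat; ring.
- rewrite laguerreSS !(derivD, derivN, derivZ, derivM, derivX, derivC) !IH//.
  rewrite !(laguerreSS b k) -!mul_polyC !rmorphD/= !rmorph_nat.
  by ring.
Qed.

(** Under the normalized weight, x^2 has the Gamma law of parameter 1/2, and parameters of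
    independent Gamma variables add. The recurrence again comes from Stein's identity. *)
Lemma gauss_int_square b k (a : R) :
  gauss_int (laguerre b k \Po (a%:P + 'X ^+ 2)) =
  Num.sqrt pi * (laguerre (b + 2^-1) k).[a].
Proof.
set l := a%:P + _.
have step q : gauss_int (('X * q) \Po l) =
    a * gauss_int (q \Po l) + 2^-1 * gauss_int (q \Po l)
    + gauss_int (('X * q^`()) \Po l) - a * gauss_int (q^`() \Po l).
  have comp r : ('X * r) \Po l = a *: (r \Po l) + 'X^2 * (r \Po l).
    by rewrite comp_polyM comp_polyX mulrDl mul_polyC.
  have X2 r : gauss_int ('X^2 * (r \Po l)) =
      2^-1 * gauss_int (r \Po l) + gauss_int ('X^2 * (r^`() \Po l)).
    rewrite {1}expr2 -mulrA gauss_intXM derivM derivX mul1r deriv_comp.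
    rewrite [in l^`()]/l !(derivD, derivC, derivXn) add0r expr1.
    rewrite (_ : 'X * (_ * _) = 2 *: ('X^2 * (r^`() \Po l))); last first.
      by rewrite -mul_polyC rmorph_nat; ring.
    by rewrite linearD/= linearZ/=; field.
  have GD (p r : {poly R}) : gauss_int (a *: p + r) = a * gauss_int p + gauss_int r.
    by rewrite linearD/= linearZ.
  by rewrite !comp !GD X2; ring.
elim/ltn_ind: k => -[|[|k]] IH.
- by rewrite !laguerre0 comp_polyC gauss_int1 hornerC mulr1.
- have gC c : gauss_int c%:P = c * Num.sqrt pi.
    by rewrite -[c%:P]mulr1 mul_polyC linearZ/= gauss_int1.
  rewrite !laguerre1 hornerD hornerX hornerC comp_polyD comp_polyC linearD/= gC.
  rewrite -['X in LHS]mulr1 step deriv_one mulr0 comp_poly0 linear0 comp_polyC gauss_int1.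
  by ring.
- rewrite laguerreSS mulrDl comp_polyB !comp_polyD comp_polyZ linearB linearD/=.
  rewrite linearZ/= step deriv_laguerre.
  rewrite mul_polyC -scalerAr !comp_polyZ !linearZ/= !IH//.
  rewrite [in RHS]laguerreSS !(hornerD, hornerN, hornerM, hornerZ, hornerX, hornerC).
  by rewrite /GRing.scale/=; ring.
Qed.

Lemma laguerre_rec b k : (laguerre b k.+1).[0] = (b + k%:R) * (laguerre b k).[0].
Proof.
case: k => [|k]; first by rewrite laguerre1 laguerre0 hornerD hornerX !hornerC; ring.
rewrite laguerreSS !(hornerD, hornerN, hornerM, hornerZ, hornerX, hornerC).
by rewrite add0r mul0r mulr0 subr0.
Qed.

End GaussianMoments.

(** * Lebesgue measure on tuples *)

Section GaussianIteratedIntegral.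
Variable R : realType.

Lemma dotp_cons n (x y : R) (u v : n.-tuple R) :
  dotp (cons_tuple x u) (cons_tuple y v) = x * y + dotp u v.
Proof.
rewrite /dotp big_ord_recl; congr (_ + _).
by apply: eq_bigr => i _; rewrite !tnthS.
Qed.

Lemma dotp0 (x y : 0.-tuple R) : dotp x y = 0.
Proof. by rewrite /dotp big_ord0. Qed.

Lemma eq_leb_int n (f g : n.-tuple R -> \bar R) : f =1 g -> leb_int R f = leb_int R g.
Proof. by move=> /funext ->. Qed.

(** The shift [a] and the factor [c] are general so that the induction closes: fixing the first
    coordinate x shifts [a] by v1 x and multiplies [c] by the Gaussian of x. The outer integral then
    adds v1^2 / 2 to the variance. *)
Lemma leb_int_hermite n (v : n.-tuple R) s k (a c : R) :
  leb_int R (fun y => (c * ((hermite R s k).[a + dotp v y] * expR (- dotp y y)))%:E) =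
  (c * (Num.sqrt pi ^+ n * (hermite R (s + dotp v v / 2) k).[a]))%:E.
Proof.
elim: n v a c => [|n IH] v a c.
  by rewrite /= !dotp0 mul0r !addr0 oppr0 expR0 mulr1 mul1r.
rewrite (tuple_eta v); set v1 := thead v; set w := [tuple of behead v].
rewrite -[[tuple of _]]/(cons_tuple v1 w) /=.
under eq_integral => x _.
  rewrite (eq_leb_int n _ (fun u => ((c * gauss_fun x) *
     ((hermite R s k).[(a + v1 * x) + dotp w u] * expR (- dotp u u)))%:E)); last first.
    move=> u; rewrite !dotp_cons opprD expRD -expr2 -/(gauss_fun x) addrA.
    by congr _%:E; ring.
  rewrite IH.
  have -> : c * gauss_fun x * (Num.sqrt pi ^+ n * (hermite R (s + dotp w w / 2) k).[a + v1 * x])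
    = ((c * Num.sqrt pi ^+ n) *: (hermite R (s + dotp w w / 2) k \Po (a%:P + v1 *: 'X))).[x]
      * gauss_fun x.
    by rewrite hornerZ horner_comp hornerD hornerC hornerZ hornerX; ring.
  over.
rewrite gauss_intE linearZ/= gauss_int_affine dotp_cons; congr _%:E.
have -> : s + dotp w w / 2 + v1 ^+ 2 / 2 = s + (v1 * v1 + dotp w w) / 2 by ring.
by rewrite exprSr; ring.
Qed.

(** The same induction, with [a] shifted by x^2; each coordinate adds 1/2 to the Gamma parameter. *)
Lemma leb_int_laguerre n b k (a c : R) :
  leb_int R (fun y : n.-tuple R =>
    (c * ((laguerre R b k).[a + dotp y y] * expR (- dotp y y)))%:E) =
  (c * (Num.sqrt pi ^+ n * (laguerre R (b + n%:R / 2) k).[a]))%:E.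
Proof.
elim: n a c => [|n IH] a c.
  by rewrite /= !dotp0 mul0r !addr0 oppr0 expR0 mulr1 mul1r.
rewrite /=; under eq_integral => x _.
  rewrite (eq_leb_int n _ (fun u => ((c * gauss_fun x) *
     ((laguerre R b k).[(a + x ^+ 2) + dotp u u] * expR (- dotp u u)))%:E)); last first.
    move=> u; rewrite !dotp_cons opprD expRD -expr2 -/(gauss_fun x) addrA.
    by congr _%:E; ring.
  rewrite IH.
  have -> : c * gauss_fun x * (Num.sqrt pi ^+ n * (laguerre R (b + n%:R / 2) k).[a + x ^+ 2])
    = ((c * Num.sqrt pi ^+ n) *: (laguerre R (b + n%:R / 2) k \Po (a%:P + 'X ^+ 2))).[x]
      * gauss_fun x.
    by rewrite hornerZ horner_comp hornerD hornerC hornerXn; ring.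
  over.
rewrite gauss_intE linearZ/= gauss_int_square; congr _%:E.
have -> : b + n%:R / 2 + 2^-1 = b + n.+1%:R / 2 by rewrite -natr1; ring.
by rewrite exprSr; ring.
Qed.

(** A Gaussian of variance 0 is constant, so its moment polynomials are the plain powers. *)
Lemma hermite_s0 k : hermite R 0 k = 'X^k.
Proof.
elim/ltn_ind: k => -[|[|k]] IH; rewrite ?hermite0 ?hermite1//.
by rewrite hermiteSS mul0r scale0r addr0 IH// exprS.
Qed.

Lemma laguerre_b0 k : laguerre R 0 k = 'X^k.
Proof.
elim/ltn_ind: k => -[|[|k]] IH; rewrite ?laguerre0 ?laguerre1 ?addr0//.
by rewrite laguerreSS !IH// -mul_polyC !rmorphD/= !rmorph_nat !exprS; ring.
Qed.

Lemma leb_int_gauss_dotp n (v : n.-tuple R) k : leb_int R (fun y =>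
    (dotp v y ^+ k * expR (- dotp y y))%:E) =
  (Num.sqrt pi ^+ n * (hermite R (dotp v v / 2) k).[0])%:E.
Proof.
have := leb_int_hermite n v 0 k 0 1; rewrite !mul1r add0r => <-.
by apply: eq_leb_int => y; rewrite mul1r hermite_s0 hornerXn add0r.
Qed.

Lemma leb_int_gauss_norm n k : leb_int R (fun y : n.-tuple R =>
    (dotp y y ^+ k * expR (- dotp y y))%:E) =
  (Num.sqrt pi ^+ n * (laguerre R (n%:R / 2) k).[0])%:E.
Proof.
have := leb_int_laguerre n 0 k 0 1; rewrite !mul1r add0r => <-.
by apply: eq_leb_int => y; rewrite mul1r laguerre_b0 hornerXn add0r.
Qed.

End GaussianIteratedIntegral.

(** * A measure representing the iterated integral, and its homogeneity *)

Section LebesgueTupleMeasure.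
Variable R : realType.
Local Notation mu := (@lebesgue_measure R).

Definition cons_pair n (p : measurableTypeR R * n.-tuple R) : n.+1.-tuple R :=
  cons_tuple (p.1 : R) p.2.

Definition uncons n (y : n.+1.-tuple R) : measurableTypeR R * n.-tuple R :=
  (thead y : measurableTypeR R, [tuple of behead y]).

Lemma cons_pairK n : cancel (cons_pair n) (uncons n).
Proof. by move=> [x u]; rewrite /uncons /cons_pair; congr pair; apply: val_inj. Qed.

Lemma measurable_cons_pair n : measurable_fun setT (cons_pair n).
Proof.
have m1 : measurable_fun [set: measurableTypeR R * n.-tuple R]
  (fun p : measurableTypeR R * n.-tuple R => p.1 : R).
  exact (@measurable_fst _ _ (measurableTypeR R) (n.-tuple R)).
exact (measurable_cons m1 (@measurable_snd _ _ (measurableTypeR R) (n.-tuple R))).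
Qed.

Lemma measurable_uncons n : measurable_fun setT (uncons n).
Proof.
apply/measurable_fun_pairP; split.
  exact (@measurable_tnth _ R n.+1 ord0).
exact (@measurable_behead _ R n).
Qed.

(** Each step takes the image under [cons_pair] of the product with one-dimensional Lebesgue
    measure, and Tonelli identifies the integrals. Sigma-finiteness is part of the induction because
    the next product and Tonelli need it. *)
Lemma leb_meas_exists n :
  {m : {sigma_finite_measure set (n.-tuple R) -> \bar R} |
   forall g : n.-tuple R -> \bar R, (forall y, (0 <= g y)%E) ->
     measurable_fun setT g -> leb_int R g = (\int[m]_y g y)%E}.
Proof.
elim: n => [|n [m Hm]].
  exists (\d_([tuple] : 0.-tuple R))%R => g g0 mg.
  by rewrite integral_dirac// diracT mul1e.
pose M0 : {measure set (n.+1.-tuple R) -> \bar R} :=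
  pushforward (mu \x m)%E (cons_pair n).
pose M := M0 (measurable_cons_pair n).
have MF : sigma_finite setT M.
  have /sigma_finiteP[F [FT ndF Ffin]] := sigma_finiteT (@lebesgue_measure R).
  have /sigma_finiteP[G [GT ndG Gfin]] := sigma_finiteT m.
  exists (fun i => uncons n @^-1` (F i `*` G i)).
    rewrite -preimage_bigcup (_ : \bigcup_i _ = setT) ?preimage_setT//.
    apply/seteqP; split => // -[x u] _.
    have [i _ Fx] : (\bigcup_i F i) x by rewrite -FT.
    have [j _ Gu] : (\bigcup_i G i) u by rewrite -GT.
    exists (maxn i j) => //; split => /=.
      by move: x Fx; apply/subsetPset/ndF/leq_maxl.
    by move: u Gu; apply/subsetPset/ndG/leq_maxr.
  move=> i; have [mF muF] := Ffin i; have [mG muG] := Gfin i.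
  have mFG := measurableX mF mG; split.
    by rewrite -[X in measurable X]setTI; exact: measurable_uncons.
  rewrite /M/= /pushforward (_ : _ @^-1` _ = F i `*` G i); last first.
    by apply/seteqP; split => p; rewrite /preimage /mkset cons_pairK.
  by rewrite product_measure1E// lte_mul_pinfty// ge0_fin_numE.
pose M' : {sigma_finite_measure set (n.+1.-tuple R) -> \bar R} :=
  HB.pack_for (SigmaFiniteMeasure.type (n.+1.-tuple R) R) (Measure.sort M)
    (Measure_isSigmaFinite.Build _ _ _ (Measure.sort M) MF).
exists M' => g g0 mg.
have mgc : measurable_fun setT (g \o cons_pair n).
  exact: measurableT_comp mg (measurable_cons_pair n).
rewrite [RHS]ge0_integral_pushforward//; last exact: measurable_cons_pair.
rewrite preimage_setT fubini_tonelli1//=.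
apply: eq_integral => x _; rewrite Hm//.
exact: (measurableT_comp mgc (measurable_pair1 x)).
Qed.

Definition leb_meas n : {sigma_finite_measure set (n.-tuple R) -> \bar R} :=
  sval (leb_meas_exists n).

Lemma leb_intE n (g : n.-tuple R -> \bar R) : (forall y, (0 <= g y)%E) ->
  measurable_fun setT g -> leb_int R g = (\int[leb_meas n]_y g y)%E.
Proof. exact: (svalP (leb_meas_exists n)). Qed.

(** The image of Lebesgue measure under multiplication by s, times |s|, gives half-open intervals
    their length, so it is Lebesgue measure by uniqueness. For s < 0 the closed end of the interval
    changes side. *)
Lemma lebesgue_measure_scale (s : R) (f : R -> \bar R) : s != 0 ->
  measurable_fun [set: measurableTypeR R] f -> (forall x, (0 <= f x)%E) ->
  (\int[mu]_x f x = `|s|%:E * \int[mu]_x f (s * x)%R)%E.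
Proof.
move=> s0 mf f0.
have ms : measurable_fun [set: measurableTypeR R]
    (fun x : measurableTypeR R => s * x : measurableTypeR R).
  exact (continuous_measurable_fun (@mulrl_continuous R s)).
have k0 : 0 <= `|s| by [].
pose P0 : {measure set (measurableTypeR R) -> \bar R} :=
  pushforward mu (fun x : measurableTypeR R => s * x : measurableTypeR R).
pose nu : {measure set (measurableTypeR R) -> \bar R} :=
  mscale (NngNum k0) (P0 ms).
rewrite (@eq_measure_integral _ _ _ _ nu); last first.
  move=> A mA _; apply: lebesgue_measure_unique => //= _ [[a b]] _ <-.
  rewrite /nu/= /mscale/= /pushforward.
  have [s1|s1] := ltP 0 s.
    rewrite (_ : _ @^-1` _ = `]a / s, b / s]%classic); last first.
      by apply/seteqP; split => x /=; rewrite !in_itv/= ltr_pdivrMr// ler_pdivlMr// mulrC.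
    rewrite !lebesgue_measure_itv/= !lte_fin ltr_pM2r ?invr_gt0// gtr0_norm//.
    case: ifPn; rewrite ?mule0// => _; rewrite -!EFinB -EFinM; congr _%:E.
    by field.
  have {}s1 : s < 0 by rewrite lt_neqAle s0.
  rewrite (_ : _ @^-1` _ = `[b / s, a / s[%classic); last first.
    by apply/seteqP; split => x /=; rewrite !in_itv/= ler_ndivrMr// ltr_ndivlMr// mulrC andbC.
  rewrite !lebesgue_measure_itv/= !lte_fin ltr_nM2r ?invr_lt0// ltr0_norm//.
  case: ifPn; rewrite ?mule0// => _; rewrite -!EFinB -EFinM; congr _%:E.
  by field.
rewrite ge0_integral_mscale// ge0_integral_pushforward//.
Qed.

Definition scale_tuple n (s : R) (y : n.-tuple R) : n.-tuple R :=
  map_tuple (fun c => s * c) y.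

Lemma measurable_scale_tuple n s : measurable_fun setT (scale_tuple n s).
Proof.
apply/measurable_fun_tnthP => i.
rewrite (_ : _ \o _ = (fun y => s * tnth y i)); last first.
  by apply/funext => y /=; rewrite tnth_map.
by apply: measurable_funM => //; exact: measurable_tnth.
Qed.

(** Positive s serves the polar substitutions; s = -1 gives the reflection that annihilates odd
    moments. *)
Lemma leb_meas_scale n (s : R) (g : n.-tuple R -> \bar R) : s != 0 ->
  (forall y, (0 <= g y)%E) -> measurable_fun setT g ->
  (\int[leb_meas n]_y g y = (`|s| ^+ n)%:E * \int[leb_meas n]_y g (scale_tuple n s y))%E.
Proof.
move=> s0 g0 mg.
have mgs : measurable_fun setT (fun y => g (scale_tuple n s y)).
  exact: measurableT_comp mg (measurable_scale_tuple n s).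
rewrite -!leb_intE//; elim: n g g0 mg {mgs} => [|n IH] g g0 mg.
  by rewrite /= expr0 mul1e; congr g; apply: val_inj.
have mgc : measurable_fun setT (fun p => g (cons_pair n p)).
  exact: measurableT_comp mg (measurable_cons_pair n).
have mgx x : measurable_fun setT (fun u : n.-tuple R => g (cons_tuple x u)).
  exact: (measurableT_comp mgc (measurable_pair1 x)).
have mgs x : measurable_fun setT (fun u : n.-tuple R => g (cons_tuple x (scale_tuple n s u))).
  exact: measurableT_comp (mgx x) (measurable_scale_tuple n s).
rewrite /=; under eq_integral do rewrite IH//.
have ms2 : measurable_fun setT (fun p : measurableTypeR R * n.-tuple R =>
    g (cons_tuple (p.1 : R) (scale_tuple n s p.2))).
  rewrite (_ : (fun p => _) =
    (fun p => g (cons_pair n p)) \o (fun p => (p.1, scale_tuple n s p.2)))//.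
  apply: measurableT_comp mgc _; apply/measurable_fun_pairP; split.
    exact (@measurable_fst _ _ (measurableTypeR R) (n.-tuple R)).
  exact: measurableT_comp (measurable_scale_tuple n s)
    (@measurable_snd _ _ (measurableTypeR R) (n.-tuple R)).
have mH : measurable_fun [set: measurableTypeR R]
    (fun x => leb_int R (fun u : n.-tuple R => g (cons_tuple x (scale_tuple n s u)))).
  under eq_fun do rewrite leb_intE//.
  by have := @measurable_fun_fubini_tonelli_F _ _ _ _ _ (leb_meas n) _ ms2; apply.
have H0 x : (0 <= leb_int R (fun u : n.-tuple R => g (cons_tuple x (scale_tuple n s u))))%E.
  by rewrite leb_intE//; apply: integral_ge0.
rewrite ge0_integralZl ?lee_fin ?exprn_ge0//.
rewrite (lebesgue_measure_scale s)// muleA -EFinM exprSr; congr (_ * _)%E.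
apply: eq_integral => x _; apply: eq_leb_int => u; congr g.
exact: val_inj.
Qed.

End LebesgueTupleMeasure.

(** * Polar integration *)

Section PolarIntegration.
Variable R : realType.

Definition enorm n (y : n.-tuple R) : R := Num.sqrt (dotp y y).

Lemma dotp_ge0 n (y : n.-tuple R) : 0 <= dotp y y.
Proof. by apply: sumr_ge0 => i _; rewrite -expr2 sqr_ge0. Qed.

Lemma enorm_ge0 n (y : n.-tuple R) : 0 <= enorm n y.
Proof. exact: sqrtr_ge0. Qed.

Lemma enorm_sqr n (y : n.-tuple R) : enorm n y ^+ 2 = dotp y y.
Proof. by rewrite /enorm sqr_sqrtr ?dotp_ge0. Qed.

Lemma enorm_gt0 n (y : n.-tuple R) : (0 < enorm n y) = (enorm n y != 0).
Proof. by rewrite lt_neqAle enorm_ge0 andbT eq_sym. Qed.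

Lemma dotp_scaler n s (x y : n.-tuple R) : dotp x (scale_tuple R n s y) = s * dotp x y.
Proof.
by rewrite /dotp mulr_sumr; apply: eq_bigr => i _; rewrite tnth_map mulrCA.
Qed.

Lemma dotpC n (x y : n.-tuple R) : dotp x y = dotp y x.
Proof. by apply: eq_bigr => i _; rewrite mulrC. Qed.

Lemma enorm_scale n s (y : n.-tuple R) : enorm n (scale_tuple R n s y) = `|s| * enorm n y.
Proof.
by rewrite /enorm dotp_scaler dotpC dotp_scaler mulrA -expr2 sqrtrM ?sqr_ge0// sqrtr_sqr.
Qed.

Lemma radialE n (y : n.-tuple R) : radial y = scale_tuple R n (enorm n y)^-1 y.
Proof. by apply: eq_from_tnth => i; rewrite !tnth_map mulrC. Qed.

Lemma radial_scale n s (y : n.-tuple R) : 0 < s ->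
  radial (scale_tuple R n s y) = radial y.
Proof.
move=> s0; rewrite !radialE enorm_scale gtr0_norm//.
apply: eq_from_tnth => i; rewrite !tnth_map invfM mulrACA.
by rewrite mulVf ?mul1r// gt_eqF.
Qed.

Lemma radial_opp n (y : n.-tuple R) :
  radial (scale_tuple R n (-1) y) = scale_tuple R n (-1) (radial y).
Proof.
rewrite !radialE enorm_scale normrN1 mul1r.
by apply: eq_from_tnth => i; rewrite !tnth_map mulrCA.
Qed.

Lemma measurable_dotp n (x : n.-tuple R) : measurable_fun setT (dotp x).
Proof.
apply: measurable_sum => i; apply: measurable_funM => //; exact: measurable_tnth.
Qed.

Lemma measurable_enorm n : measurable_fun setT (enorm n).
Proof.
apply: (measurableT_comp (continuous_measurable_fun (@sqrt_continuous R))).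
by apply: measurable_sum => i; apply: measurable_funM; exact: measurable_tnth.
Qed.

Lemma measurable_enormV n : measurable_fun setT (fun y => (enorm n y)^-1).
Proof.
rewrite (_ : (fun y => _) = (fun y => enorm n y `^ (-1))).
  exact: (measurableT_comp (measurable_powR _) (measurable_enorm n)).
by apply/funext => y; rewrite powR_inv1// enorm_ge0.
Qed.

Lemma measurable_radial n : measurable_fun setT (@radial R n).
Proof.
apply/measurable_fun_tnthP => i.
rewrite (_ : _ \o _ = (fun y => (enorm n y)^-1 * tnth y i)); last first.
  by apply/funext => y /=; rewrite radialE tnth_map.
apply: measurable_funM; [exact: measurable_enormV|exact: measurable_tnth].
Qed.

(** Radius 0 is excluded so that the gauge vanishes at 0 and also at the inverse of 0, which is 0 by
    convention; points of norm 0 are then harmless in the substitutions of [polar_identity]. *)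
Definition unit_gauge (r : R) : R := (0 < r <= 1)%R%:R.

Lemma unit_gauge0 : unit_gauge 0 = 0.
Proof. by rewrite /unit_gauge ltxx. Qed.

Lemma unit_gauge_ge0 r : 0 <= unit_gauge r.
Proof. exact: ler0n. Qed.

Lemma measurable_unit_gauge : measurable_fun setT unit_gauge.
Proof.
rewrite (_ : unit_gauge = \1_(`]0, 1]%classic)); first exact: measurable_indic.
by apply/funext => r; rewrite /unit_gauge indicE mem_setE in_itv.
Qed.

Lemma leb_meas_scaleR n (s : R) (F : n.-tuple R -> R) : 0 < s ->
  (forall y, 0 <= F y) -> measurable_fun setT F ->
  (\int[leb_meas R n]_y (F y)%:E =
   \int[leb_meas R n]_y (s ^+ n * F (scale_tuple R n s y))%:E)%E.
Proof.
move=> s0 F0 mF; rewrite (leb_meas_scale R n s (EFin \o F)) ?gt_eqF//=; last exact/measurable_EFinP.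
rewrite gtr0_norm// -ge0_integralZl ?lee_fin ?exprn_ge0 ?ltW//.
  by apply/measurable_EFinP; exact: measurableT_comp mF (measurable_scale_tuple R n s).
by move=> y _; rewrite lee_fin.
Qed.

Lemma polar_swap n (F : n.-tuple R -> n.-tuple R -> R) :
  (forall y z, 0 <= F y z) -> measurable_fun setT (fun p => F p.1 p.2) ->
  (\int[leb_meas R n]_y \int[leb_meas R n]_z (F y z)%:E =
   \int[leb_meas R n]_z \int[leb_meas R n]_y (F y z)%:E)%E.
Proof.
move=> F0 mF.
apply: (@fubini_tonelli _ _ _ _ _ (leb_meas R n) (leb_meas R n) (fun p => (F p.1 p.2)%:E)).
  exact/measurable_EFinP.
by move=> p; rewrite lee_fin.
Qed.

Section PolarIdentity.
Variables (n : nat) (h : n.-tuple R -> R) (phi : R -> R).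
Hypotheses (h0 : forall y, 0 <= h y) (mh : measurable_fun setT h).
Hypotheses (phi_ge0 : forall r, 0 <= phi r) (mphi : measurable_fun setT phi).
Hypothesis phi0 : phi 0 = 0.
Hypothesis h_scale : forall s y, 0 < s -> h (scale_tuple R n s y) = h y.
Local Notation m := (leb_meas R n).
Local Notation N := (enorm n).
Local Notation bet := unit_gauge.

Let m1 (f : n.-tuple R -> R) : measurable_fun setT f ->
  measurable_fun setT (fun p : n.-tuple R * n.-tuple R => f p.1).
Proof. by move=> mf; exact: measurableT_comp mf (@measurable_fst _ _ _ _). Qed.

Let m2 (f : n.-tuple R -> R) : measurable_fun setT f ->
  measurable_fun setT (fun p : n.-tuple R * n.-tuple R => f p.2).
Proof. by move=> mf; exact: measurableT_comp mf (@measurable_snd _ _ _ _). Qed.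

Let mT d (T : measurableType d) (f : R -> R) (g : T -> R) : measurable_fun setT f ->
  measurable_fun setT g -> measurable_fun setT (fun x => f (g x)).
Proof. by move=> mf mg; exact: measurableT_comp mf mg. Qed.

Let mN := measurable_enorm n.
Let mNV := measurable_enormV n.
Let mb := measurable_unit_gauge.

(* Scaling in [z], then in [y], then in [z] again: the integrals in [y] and [z]
   exchange their radial factors. *)
Lemma polar_identity :
  ((\int[m]_y (h y * phi (N y))%:E) * (\int[m]_z (bet (N z))%:E) =
   (\int[m]_z (phi (N z))%:E) *
   (\int[m]_y (h y * ((N y)^-1 ^+ n * (N y)^-1 ^+ n * bet (N y)^-1))%:E))%E.
Proof.
transitivity (\int[m]_y \int[m]_z (h y * phi (N y) * bet (N z))%:E)%E.
  rewrite -ge0_integralZr//; last 3 first.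
  - by apply/measurable_EFinP; apply: measurable_funM => //; exact: mT.
  - by move=> y _; rewrite lee_fin mulr_ge0.
  - by apply: integral_ge0 => z _; rewrite lee_fin unit_gauge_ge0.
  apply: eq_integral => y _; rewrite -ge0_integralZl//.
  - by apply/measurable_EFinP; exact: mT.
  - by move=> z _; rewrite lee_fin unit_gauge_ge0.
  - by rewrite lee_fin mulr_ge0.
transitivity (\int[m]_y \int[m]_z
    (h y * phi (N y) * (N y)^-1 ^+ n * bet ((N y)^-1 * N z))%:E)%E.
  apply: eq_integral => y _; have [y0|y0] := eqVneq (N y) 0.
    by apply: eq_integral => z _; rewrite y0 phi0 mulr0 !mul0r.
  have s0 : 0 < (N y)^-1 by rewrite invr_gt0 enorm_gt0.
  rewrite (leb_meas_scaleR n (N y)^-1)//.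
  - by apply: eq_integral => z _; rewrite enorm_scale gtr0_norm//; congr _%:E; ring.
  - by move=> z; rewrite !mulr_ge0 ?unit_gauge_ge0.
  - by apply: measurable_funM => //; exact: mT.
rewrite polar_swap; last 2 first.
- by move=> y z; rewrite !mulr_ge0 ?exprn_ge0 ?invr_ge0 ?enorm_ge0 ?unit_gauge_ge0.
- apply: measurable_funM; first apply: measurable_funM; first apply: measurable_funM.
  + exact: m1.
  + by apply: (@m1 (fun y => phi (N y))); exact: mT.
  + by apply: measurable_funX; exact: (m1 _ mNV).
  + apply: mT => //; apply: measurable_funM; [exact: (m1 _ mNV)|exact: (m2 _ mN)].
(* Scaling [y] by [N z] leaves [h] unchanged, cancels the powers of [N z] and removes [z] from the
   gauge. *)
transitivity (\int[m]_z \int[m]_y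
    (h y * phi (N z * N y) * (N y)^-1 ^+ n * bet (N y)^-1)%:E)%E.
  apply: eq_integral => z _; have [z0|z0] := eqVneq (N z) 0.
    by apply: eq_integral => y _; rewrite z0 mul0r phi0 !mulr0 unit_gauge0 !mul0r mulr0.
  have s0 : 0 < N z by rewrite enorm_gt0.
  rewrite (leb_meas_scaleR n (N z))//.
  - apply: eq_integral => y _; rewrite enorm_scale gtr0_norm// h_scale//; congr _%:E.
    have -> : (N z * N y)^-1 * N z = (N y)^-1 by rewrite invfM mulrAC mulVf// mul1r.
    rewrite invfM [X in _ * X * _]exprMn.
    transitivity (N z ^+ n * (N z)^-1 ^+ n *
      (h y * phi (N z * N y) * (N y)^-1 ^+ n * bet (N y)^-1)).
      by ring.
    by rewrite -exprMn mulfV// expr1n mul1r.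
  - by move=> y; rewrite !mulr_ge0 ?exprn_ge0 ?invr_ge0 ?enorm_ge0 ?unit_gauge_ge0.
  - apply: measurable_funM; first apply: measurable_funM; first apply: measurable_funM => //.
    + exact: mT.
    + exact: measurable_funX.
    + by apply: mT => //; apply: measurable_funM.
rewrite -polar_swap; last 2 first.
- by move=> y z; rewrite !mulr_ge0 ?exprn_ge0 ?invr_ge0 ?enorm_ge0 ?unit_gauge_ge0.
- apply: measurable_funM; first apply: measurable_funM; first apply: measurable_funM.
  + exact: m1.
  + apply: mT => //; apply: measurable_funM; [exact: (m2 _ mN)|exact: (m1 _ mN)].
  + by apply: measurable_funX; exact: (m1 _ mNV).
  + by apply: mT => //; exact: (m1 _ mNV).
(* Scaling [z] by [(N y)^-1] turns [phi (N z * N y)] into [phi (N z)], and the variables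
   separate. *)
transitivity (\int[m]_y \int[m]_z
    (h y * ((N y)^-1 ^+ n * (N y)^-1 ^+ n * bet (N y)^-1) * phi (N z))%:E)%E.
  apply: eq_integral => y _; have [y0|y0] := eqVneq (N y) 0.
    by apply: eq_integral => z _; rewrite y0 invr0 unit_gauge0 !(mulr0, mul0r).
  have s0 : 0 < (N y)^-1 by rewrite invr_gt0 enorm_gt0.
  rewrite (leb_meas_scaleR n (N y)^-1)//.
  - apply: eq_integral => z _; rewrite enorm_scale gtr0_norm//.
    have -> : (N y)^-1 * N z * N y = N z by rewrite mulrAC mulVf// mul1r.
    by congr _%:E; ring.
  - by move=> z; rewrite !mulr_ge0 ?exprn_ge0 ?invr_ge0 ?enorm_ge0 ?unit_gauge_ge0.
  - apply: measurable_funM => //; apply: measurable_funM => //; apply: measurable_funM => //.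
    by apply: mT => //; apply: measurable_funM.
rewrite muleC -ge0_integralZr//; last 3 first.
- apply/measurable_EFinP; apply: measurable_funM => //; apply: measurable_funM.
    by apply: measurable_funM; exact: measurable_funX.
  exact: mT.
- by move=> y _; rewrite lee_fin !mulr_ge0 ?exprn_ge0 ?invr_ge0 ?enorm_ge0 ?unit_gauge_ge0.
- by apply: integral_ge0 => z _; rewrite lee_fin.
apply: eq_integral => y _; rewrite -ge0_integralZl//.
- by apply/measurable_EFinP; exact: mT.
- by move=> z _; rewrite lee_fin.
- by rewrite lee_fin !mulr_ge0 ?exprn_ge0 ?invr_ge0 ?enorm_ge0 ?unit_gauge_ge0.
Qed.

End PolarIdentity.
End PolarIntegration.

(** * Zonal integrals *)

Section ZonalIntegrals.
Variables (R : realType) (n : nat) (x : n.-tuple R).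
Hypothesis x_unit : dotp x x = 1.
Local Notation m := (leb_meas R n).
Local Notation N := (enorm R n).
Local Notation sc := (scale_tuple R n).

(** Cauchy-Schwarz: the square of the norm of z - c x is nonnegative, taken at c = x.z. *)
Lemma dotp_unit_sqr_le (z : n.-tuple R) : dotp x z ^+ 2 <= dotp z z.
Proof.
have H c : 0 <= dotp z z - 2 * c * dotp x z + c ^+ 2 * dotp x x.
  rewrite (_ : _ + _ = \sum_(i < n) (tnth z i - c * tnth x i) ^+ 2).
    by apply: sumr_ge0 => i _; rewrite sqr_ge0.
  rewrite /dotp !mulr_sumr -sumrB -big_split/=.
  by apply: eq_bigr => i _; ring.
by have := H (dotp x z); rewrite x_unit; lra.
Qed.

Definition zonal (y : n.-tuple R) : R := dotp x (radial y).

Lemma zonalE y : zonal y = (N y)^-1 * dotp x y.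
Proof. by rewrite /zonal radialE dotp_scaler. Qed.

Lemma zonal_norm y : zonal y * N y = dotp x y.
Proof.
rewrite zonalE mulrAC; have [N0|N0] := eqVneq (N y) 0; last by rewrite mulVf ?mul1r.
rewrite N0 mulr0 mul0r; apply/esym/eqP; rewrite -sqrf_eq0 eq_le sqr_ge0 andbT.
by rewrite (le_trans (dotp_unit_sqr_le y))// -enorm_sqr N0 expr0n.
Qed.

Lemma zonal_le1 y : `|zonal y| <= 1.
Proof.
rewrite -(@ler_pXn2r _ 2)// ?nnegrE// expr1n real_normK ?num_real//.
rewrite (le_trans (dotp_unit_sqr_le _))// -enorm_sqr radialE enorm_scale.
have [->|N0] := eqVneq (N y) 0; first by rewrite mulr0 expr0n.
by rewrite ger0_norm ?invr_ge0 ?enorm_ge0// mulVf// expr1n.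
Qed.

Lemma zonal_scale s y : 0 < s -> zonal (sc s y) = zonal y.
Proof. by move=> s0; rewrite /zonal radial_scale. Qed.

Lemma zonal_opp y : zonal (sc (-1) y) = - zonal y.
Proof. by rewrite /zonal radial_opp dotp_scaler mulN1r. Qed.

Lemma measurable_zonal : measurable_fun setT zonal.
Proof. exact: measurableT_comp (measurable_dotp R n x) (measurable_radial R n). Qed.

(** The indicator of the ball is split into the punctured ball, whose weight vanishes at radius 0 as
    [polar_identity] demands, and the origin, treated as a null set. *)
Definition ball_weight (y : n.-tuple R) : R := unit_gauge R (N y).
Definition origin_weight (y : n.-tuple R) : R := (N y == 0)%R%:R.

Lemma ball_weight_ge0 y : 0 <= ball_weight y.
Proof. exact: unit_gauge_ge0. Qed.

Lemma measurable_ball_weight : measurable_fun setT ball_weight.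
Proof. exact: measurableT_comp (measurable_unit_gauge R) (measurable_enorm R n). Qed.

Lemma measurable_origin_weight : measurable_fun setT origin_weight.
Proof.
rewrite (_ : origin_weight = (\1_[set 0]) \o N).
  by apply: measurableT_comp (measurable_enorm R n); exact: measurable_indic.
apply/funext => y; rewrite /origin_weight /= indicE.
have [->|ne] := eqVneq (N y) 0; first by rewrite mem_set.
by rewrite memNset//=; exact/eqP.
Qed.

Lemma indic_unit_ball y : \1_(unit_ball R n) y = ball_weight y + origin_weight y :> R.
Proof.
rewrite indicE /ball_weight /origin_weight /unit_gauge.
rewrite (_ : (y \in unit_ball R n) = (N y <= 1)); last first.
  rewrite -(@ler_pXn2r _ 2)// ?nnegrE ?enorm_ge0// enorm_sqr expr1n.
  by apply/idP/idP; rewrite inE.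
have [->|N0] := eqVneq (N y) 0; first by rewrite ltxx ler01 add0r.
by rewrite enorm_gt0 N0/= addr0.
Qed.

Lemma measurable_gauss_weight : measurable_fun setT (fun y : n.-tuple R => expR (- dotp y y)).
Proof.
apply: measurableT_comp; first exact: measurable_expR.
apply: measurableT_comp; first exact: oppr_measurable.
by apply: measurable_sum => i; apply: measurable_funM; exact: measurable_tnth.
Qed.

Lemma measurable_dotp_diag : measurable_fun setT (fun y : n.-tuple R => dotp y y).
Proof. by apply: measurable_sum => i; apply: measurable_funM; exact: measurable_tnth. Qed.

Lemma integrable_gauss_weight :
  m.-integrable setT (EFin \o (fun y : n.-tuple R => expR (- dotp y y))).
Proof.
apply/integrableP; split.
  by apply/measurable_EFinP; exact: measurable_gauss_weight.
under eq_integral do rewrite /= ger0_norm ?expR_ge0//.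
rewrite -leb_intE; last 2 first.
  by move=> y; rewrite lee_fin expR_ge0.
  by apply/measurable_EFinP; exact: measurable_gauss_weight.
have := leb_int_gauss_norm R n 0; under eq_fun do rewrite expr0 mul1r.
by move=> ->; rewrite ltry.
Qed.

(** On the ball 1 <= exp(1 - |y|^2), so the Gaussian, whose integral is already known to be finite,
    is a majorant up to a constant. *)
Lemma integrable_in_ball (f : n.-tuple R -> R) (C : R) : measurable_fun setT f ->
  (forall y, `|f y| <= C * (N y <= 1)%R%:R) -> m.-integrable setT (EFin \o f).
Proof.
move=> mf fC.
apply: le_integrable (integrableZl measurableT (C * expR 1) integrable_gauss_weight) => //.
  exact/measurable_EFinP.
move=> y _; rewrite lee_fin/= (le_trans (fC y))// (le_trans _ (ler_norm _))//.
rewrite -mulrA -expRD; have C0 : 0 <= C * (N y <= 1)%R%:R by rewrite (le_trans _ (fC y)).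
move: C0; case: (leP (N y) 1) => N1; rewrite ?mulr0.
  rewrite mulr1 => C0; rewrite ler_peMr// -[leLHS]expR0 ler_expR subr_ge0 -enorm_sqr.
  by rewrite expr_le1// enorm_ge0.
move=> _; apply: mulr_ge0; last exact: expR_ge0.
(* Evaluating the bound at the origin shows that [C] is nonnegative. *)
by have := fC (sc 0 y); rewrite enorm_scale normr0 mul0r ler01 mulr1; apply: le_trans.
Qed.

Lemma horner_norm_le (q : {poly R}) (s : R) : `|s| <= 1 ->
  `|q.[s]| <= \sum_(i < size q) `|q`_i|.
Proof.
move=> s1; rewrite horner_coef (le_trans (ler_norm_sum _ _ _))//.
apply: ler_sum => i _; rewrite normrM ler_piMr// normrX.
by rewrite exprn_ile1.
Qed.

Lemma measurable_zonal_poly (q : {poly R}) : measurable_fun setT (fun y => q.[zonal y]).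
Proof.
exact: measurableT_comp (continuous_measurable_fun (@continuous_horner _ q)) measurable_zonal.
Qed.

Lemma measurable_weighted_zonal q :
  measurable_fun setT (fun y => ball_weight y * q.[zonal y]).
Proof. exact: measurable_funM measurable_ball_weight (measurable_zonal_poly q). Qed.

Lemma integrable_zonal (q : {poly R}) :
  m.-integrable setT (EFin \o (fun y => ball_weight y * q.[zonal y])).
Proof.
apply: (@integrable_in_ball _ (\sum_(i < size q) `|q`_i|)).
  exact: measurable_weighted_zonal.
move=> y; rewrite normrM mulrC ler_pM// ?horner_norm_le ?zonal_le1//.
rewrite ger0_norm ?ball_weight_ge0// /ball_weight /unit_gauge.
by case: (0 < N y) => //=; rewrite ler0n.
Qed.

Definition zonal_int (q : {poly R}) : R :=
  (\int[m]_y (ball_weight y * q.[zonal y]))%R.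

Lemma zonal_intE q :
  (\int[m]_y (ball_weight y * q.[zonal y])%:E)%E = (zonal_int q)%:E.
Proof.
by rewrite /zonal_int /Rintegral fineK//; apply: integrable_fin_num => //; exact: integrable_zonal.
Qed.

Lemma zonal_int_linear : scalar zonal_int.
Proof.
move=> a p q; rewrite /zonal_int -RintegralZl//; last exact: integrable_zonal.
rewrite -RintegralD//; last 2 first.
  have := integrableZl measurableT a (integrable_zonal p).
  by apply: eq_integrable => // y _.
  exact: integrable_zonal.
by apply: eq_Rintegral => y _; rewrite hornerD hornerZ; ring.
Qed.

HB.instance Definition _ := GRing.isLinear.Build _ _ _ _ zonal_int zonal_int_linear.

(** The reflection y -> -y exchanges the positive and negative parts; the parts are used because the
    scaling lemma concerns nonnegative functions. *)
Lemma zonal_int_odd k : odd k -> zonal_int 'X^k = 0.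
Proof.
move=> ok; apply: EFin_inj; rewrite -zonal_intE.
pose f y := (ball_weight y * ('X^k).[zonal y])%:E.
have fN y : f (sc (-1) y) = (- f y)%E.
  rewrite /f /ball_weight enorm_scale normrN1 mul1r zonal_opp !hornerXn exprNn.
  by rewrite -signr_odd ok expr1 mulN1r mulrN EFinN.
have mf : measurable_fun setT f by apply/measurable_EFinP; exact: measurable_weighted_zonal.
have If := integrable_zonal 'X^k.
rewrite -/f integralE (_ : (\int[m]_y f^\+ y = \int[m]_y f^\- y)%E).
  by rewrite subee//; exact: (integrable_fin_num measurableT (integrable_funeneg measurableT If)).
rewrite (leb_meas_scale R n (-1))//.
- rewrite normrN1 expr1n mul1e; apply: eq_integral => y _.
  by rewrite funeposE funenegE fN.
- exact: measurable_funepos.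
Qed.

(** The polar identity is applied to the same angular function with a Gaussian profile and with the
    ball profile. The angular integral [K] is common to both, so normalized moments on the ball are
    quotients of Gaussian integrals of (x.y)^(2j) and |y|^(2j). *)
Lemma zonal_int_even_gt0 j : (0 < j)%N -> zonal_int 1 != 0 ->
  zonal_int 'X^(2 * j) * (laguerre R (n%:R / 2) j).[0] =
  zonal_int 1 * (hermite R 2^-1 (2 * j)).[0].
Proof.
move=> j0 V0.
pose h (y : n.-tuple R) := zonal y ^+ (2 * j).
pose phi (r : R) := r ^+ (2 * j) * gauss_fun r.
have h0 y : 0 <= h y by rewrite /h exprM exprn_ge0 ?sqr_ge0.
have mh : measurable_fun setT h by apply: measurable_funX; exact: measurable_zonal.
have p0 r : 0 <= phi r.
  by rewrite /phi mulr_ge0 ?gauss_fun_ge0// exprM exprn_ge0 ?sqr_ge0.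
have mp : measurable_fun setT phi.
  by apply: measurable_funM; [exact: measurable_funX|exact: measurable_gauss_fun].
have pz : phi 0 = 0.
  by rewrite /phi expr0n (_ : (2 * j == 0)%N = false) ?mul0r//; lia.
have hs s y : 0 < s -> h (sc s y) = h y by move=> s0; rewrite /h zonal_scale.
have := polar_identity R n h phi h0 mh p0 mp pz hs.
have := polar_identity R n h (unit_gauge R) h0 mh (unit_gauge_ge0 R)
  (measurable_unit_gauge R) (unit_gauge0 R) hs.
set K := (\int[_]_y (h y * (_ * _))%:E)%E.
have E1 : (\int[m]_z (unit_gauge R (N z))%:E = (zonal_int 1)%:E)%E.
  by rewrite -zonal_intE; apply: eq_integral => y _; rewrite hornerC mulr1.
have E2 : (\int[m]_y (h y * unit_gauge R (N y))%:E = (zonal_int 'X^(2 * j))%:E)%E.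
  by rewrite -zonal_intE; apply: eq_integral => y _; rewrite hornerXn mulrC.
have E3 : (\int[m]_y (h y * phi (N y))%:E =
    (Num.sqrt pi ^+ n * (hermite R 2^-1 (2 * j)).[0])%:E)%E.
  have := leb_int_gauss_dotp R n x (2 * j); rewrite x_unit mul1r => <-.
  rewrite leb_intE; last 2 first.
    by move=> y; rewrite lee_fin mulr_ge0 ?expR_ge0// exprM exprn_ge0 ?sqr_ge0.
    apply/measurable_EFinP; apply: measurable_funM; last exact: measurable_gauss_weight.
    by apply: measurable_funX; exact: measurable_dotp.
  apply: eq_integral => y _; rewrite /h /phi /gauss_fun enorm_sqr mulrA -exprMn.
  by rewrite zonal_norm.
have E4 : (\int[m]_z (phi (N z))%:E =
    (Num.sqrt pi ^+ n * (laguerre R (n%:R / 2) j).[0])%:E)%E.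
  rewrite -leb_int_gauss_norm leb_intE; last 2 first.
    by move=> y; rewrite lee_fin mulr_ge0 ?expR_ge0// exprn_ge0// dotp_ge0.
    apply/measurable_EFinP; apply: measurable_funM; last exact: measurable_gauss_weight.
    by apply: measurable_funX; exact: measurable_dotp_diag.
  by apply: eq_integral => y _; rewrite /phi /gauss_fun exprM enorm_sqr.
rewrite E1 E2 E3 E4 => H1.
(* With the ball profile both radial integrals equal the volume, which is positive and cancels; this
   also excludes an infinite [K]. *)
have -> : K = (zonal_int 'X^(2 * j))%:E.
  have V0' : 0 <= zonal_int 1.
    by rewrite Rintegral_ge0// => y _; rewrite hornerC mulr1 ball_weight_ge0.
  have Vpos : 0 < zonal_int 1 by rewrite lt_neqAle eq_sym V0.
  move: H1; rewrite -EFinM; case: K => [k||].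
  - by rewrite -EFinM => -[] /eqP; rewrite mulrC => /eqP/(mulfI V0) ->.
  - by rewrite gt0_muley ?lte_fin.
  - by rewrite gt0_muleNy ?lte_fin.
rewrite -!EFinM => -[] /eqP; rewrite -!mulrA => /eqP/mulfI.
rewrite expf_neq0 ?gt_eqF ?sqrtr_gt0 ?pi_gt0// => /(_ isT) H.
by rewrite mulrC -H mulrC.
Qed.

Lemma zonal_int_even j : zonal_int 1 != 0 ->
  zonal_int 'X^(2 * j) * (laguerre R (n%:R / 2) j).[0] =
  zonal_int 1 * (hermite R 2^-1 (2 * j)).[0].
Proof.
by case: j => [_|j]; [rewrite muln0 expr0 laguerre0 hermite0 !hornerC|exact: zonal_int_even_gt0].
Qed.

(** For even k the moments involved are odd, and at k = 0 the factor k makes the truncated index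
    harmless. For k = 2j + 1 the Hermite value grows by (2j + 1)/2 and the Laguerre value by n/2 +
    j; as n = d + 1, the ratio is k / (k + d). *)
Lemma zonal_int_byparts_mono k (d : nat) : n = d.+1 -> zonal_int 1 != 0 ->
  k%:R * (zonal_int 'X^(k.-1) - zonal_int 'X^(k.+1)) = d%:R * zonal_int 'X^(k.+1).
Proof.
move=> nd V0; have [ok|ek] := boolP (odd k); last first.
  rewrite (zonal_int_odd k.+1)//=; case: k ek => [|k] ek; first by rewrite mul0r mulr0.
  by rewrite (zonal_int_odd k)/= ?subrr ?mulr0//; move: ek; rewrite /= negbK.
have [j ->] : exists j, k = (2 * j).+1.
  by exists k./2; rewrite mul2n -[LHS]odd_double_half ok.
have lag_gt0 i : 0 < (laguerre R (n%:R / 2) i).[0].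
  elim: i => [|i IH]; first by rewrite laguerre0 hornerC.
  rewrite laguerre_rec mulr_gt0//.
  have : 0 < n%:R :> R by rewrite nd.
  have : 0 <= i%:R :> R by []. lra.
have E1 := zonal_int_even j V0; have E2 := zonal_int_even j.+1 V0.
move: E2; rewrite mulnS add2n laguerre_rec hermite_even_rec.
move: E1 (lag_gt0 j) => /=; move: (zonal_int 'X^_) (zonal_int 'X^_) => b a.
move: (laguerre _ _ _).[0] (hermite _ _ _).[0] => l h E1 l0 E2.
apply: (@mulfI _ l); first by rewrite gt_eqF.
have E3 : a * l = zonal_int 1 * h by [].
have E4 : (n%:R / 2 + j%:R) * (b * l) = 2^-1 * (2 * j).+1%:R * (a * l).
  by rewrite E3; transitivity (b * ((n%:R / 2 + j%:R) * l)); [ring|rewrite E2; ring].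
transitivity (2 * (2^-1 * (2 * j).+1%:R * (a * l)) - (2 * j).+1%:R * (b * l)).
  by field.
by rewrite -E4 nd -!natr1 natrM; field.
Qed.

Lemma zonal_int_byparts (d : nat) (q : {poly R}) : n = d.+1 -> zonal_int 1 != 0 ->
  zonal_int ((1 - 'X^2) * q^`()) = d%:R * zonal_int ('X * q).
Proof.
move=> nd V0; rewrite -[q]coefK poly_def; elim: (size q) => [|i IH].
  by rewrite big_ord0 deriv0 !mulr0 linear0 mulr0.
rewrite big_ord_recr/= derivD [in LHS]mulrDr [X in _ * zonal_int X]mulrDr.
have aD p r : zonal_int (p + r) = zonal_int p + zonal_int r by rewrite linearD.
have aZ c p : zonal_int (c *: p) = c * zonal_int p by rewrite linearZ.
rewrite !aD IH [RHS]mulrDr; congr (_ + _).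
rewrite derivZ derivXn -!scalerAr !aZ [RHS]mulrCA; congr (_ * _).
rewrite -exprS -(zonal_int_byparts_mono i d nd V0).
have -> : (1 - 'X^2) * ('X^(i.-1) *+ i) = i%:R *: ('X^(i.-1) + (-1) *: 'X^(i.+1)) :> {poly R}.
  rewrite scaleN1r; case: i {IH} => [|i]; first by rewrite mulr0n scale0r mulr0.
  by rewrite scaler_nat !exprS/=; ring.
by rewrite aZ aD aZ mulN1r.
Qed.

Lemma zonal_int_jacobi (d t : nat) : n = d.+1 -> (0 < d)%N -> zonal_int 1 != 0 ->
  jacobi_dim R d t * zonal_int ((jacobi R d t \Po (1 - 'X)) ^+ 2) = zonal_int 1.
Proof.
(* In the variable u = 1 - s the factor 1 - s^2 becomes u (2 - u), and the signs from q' and from s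
   = -(u - 1) cancel. *)
move=> nd d0 V0; pose L q := zonal_int (q \Po (1 - 'X)).
have Llin : scalar L by move=> a p q; rewrite /L comp_polyD comp_polyZ zonal_int_linear.
have Lparts q : L ('X * (2%:P - 'X) * q^`()) = d%:R * L (('X - 1) * q).
  rewrite /L !(comp_polyM, comp_polyB, comp_polyX, comp_polyC).
  have -> : (1 - 'X) * (2%:P - (1 - 'X)) * (q^`() \Po (1 - 'X)) =
      (-1) *: ((1 - 'X^2) * (q \Po (1 - 'X))^`()).
    rewrite deriv_comp derivB derivX -polyC1 derivC sub0r scaleN1r rmorph_nat.
    by rewrite polyC1; ring.
  have -> : (1 - 'X - 1) * (q \Po (1 - 'X)) = (-1) *: ('X * (q \Po (1 - 'X))).
    by rewrite scaleN1r; ring.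
  by rewrite !linearZ/= (zonal_int_byparts d)// mulrCA.
have := zonal_jacobi_sqr R d L d0 Llin Lparts t.
by rewrite /L rmorphXn/= comp_polyC.
Qed.

(** The weight is invariant under scaling by 2, so its finite integral a satisfies a = 2^n a. *)
Lemma integral_origin_weight : (0 < n)%N -> (\int[m]_y (origin_weight y)%:E = 0)%E.
Proof.
move=> n0.
have w0 y : 0 <= origin_weight y by exact: ler0n.
have ww y : (0 <= (origin_weight y)%:E)%E by rewrite lee_fin.
have Iw : m.-integrable setT (EFin \o origin_weight).
  apply: (@integrable_in_ball _ 1); first exact: measurable_origin_weight.
  move=> y; rewrite mul1r ger0_norm// /origin_weight.
  by case: eqVneq => [->|_]; rewrite ?ler01// ler0n.
have : (\int[m]_y (origin_weight y)%:E)%E \is a fin_num := integrable_fin_num measurableT Iw.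
have := leb_meas_scaleR R n 2 origin_weight (ltr0n _ 2) w0 measurable_origin_weight.
under [X in _ = X -> _]eq_integral => y _.
  rewrite /origin_weight enorm_scale mulf_eq0 normr_eq0 pnatr_eq0/= -/(origin_weight y) EFinM.
  over.
rewrite ge0_integralZl ?lee_fin ?exprn_ge0//; last first.
  by apply/measurable_EFinP; exact: measurable_origin_weight.
case: (\int[m]_y _)%E => // a; rewrite -EFinM => -[] /eqP.
rewrite -subr_eq0 -{1}[a]mul1r -mulrBl mulf_eq0 => /orP[|/eqP ->//].
by rewrite subr_eq0 lt_eqF// exprn_egt1 ?ltr1n// -lt0n.
Qed.

(** At the origin [zonal] is 0 because the inverse of 0 is 0, so that point contributes [r.[0]]
    times the integral of [origin_weight], which is 0. *)
Lemma leb_int_zonal (r : {poly R}) : (0 < n)%N -> (forall s, 0 <= r.[s]) ->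
  leb_int R (fun y => ((\1_(unit_ball R n) y)%:E * (r.[zonal y])%:E)%E) =
  (zonal_int r)%:E.
Proof.
move=> n0 r0.
have mb : measurable_fun setT (fun y => ball_weight y * r.[zonal y]).
  exact: measurable_weighted_zonal.
have mo : measurable_fun setT (fun y => origin_weight y * r.[0]).
  by apply: measurable_funM => //; exact: measurable_origin_weight.
have b0 y : 0 <= ball_weight y * r.[zonal y] by rewrite mulr_ge0 ?ball_weight_ge0.
have o0 y : 0 <= origin_weight y * r.[0] by rewrite mulr_ge0// ler0n.
have E y : ((\1_(unit_ball R n) y)%:E * (r.[zonal y])%:E)%E =
    ((ball_weight y * r.[zonal y])%:E + (origin_weight y * r.[0])%:E)%E.
  rewrite -EFinM -EFinD indic_unit_ball mulrDl; congr (_ + _)%:E.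
  rewrite /origin_weight; case: eqVneq => [N0|_]; last by rewrite !mul0r.
  by rewrite zonalE N0 invr0 mul0r.
rewrite (eq_leb_int R n _ _ E) leb_intE; last 2 first.
  by move=> y; rewrite adde_ge0 ?lee_fin.
  by apply: emeasurable_funD; apply/measurable_EFinP.
rewrite ge0_integralD//; last 4 first.
- by move=> y _; rewrite lee_fin.
- exact/measurable_EFinP.
- by move=> y _; rewrite lee_fin.
- exact/measurable_EFinP.
under [X in (_ + X)%E]eq_integral do rewrite EFinM.
rewrite ge0_integralZr ?lee_fin//; last 2 first.
- by apply/measurable_EFinP; exact: measurable_origin_weight.
- by move=> y _; rewrite lee_fin ler0n.
by rewrite integral_origin_weight// mul0e adde0 zonal_intE.
Qed.

End ZonalIntegrals.

(** * Zonal polynomials as elements of Pi_t *)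

Section PolynomialEvaluation.
Variables (R : realType) (n t : nat).
Local Notation C := (complex.complex R).
Local Notation rc := (complex.real_complex R).

Definition is_peval (f : n.-tuple R -> R) :=
  exists c : {ffun 'I_n -> 'I_t.+1} -> C, forall y, peval t c y = rc (f y).

Lemma is_peval0 : is_peval (fun=> 0).
Proof.
exists (fun=> 0) => y; rewrite /peval big1 ?rmorph0// => a _.
by rewrite mul0r.
Qed.

Lemma is_pevalD f g : is_peval f -> is_peval g -> is_peval (fun y => f y + g y).
Proof.
move=> [a Ha] [b Hb]; exists (fun e => a e + b e) => y.
rewrite rmorphD/= -Ha -Hb /peval -big_split/=.
by apply: eq_bigr => e _; rewrite mulrDl.
Qed.

Lemma is_pevalZ k f : is_peval f -> is_peval (fun y => k * f y).
Proof.
move=> [a Ha]; exists (fun e => rc k * a e) => y.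
rewrite rmorphM/= -Ha /peval mulr_sumr.
by apply: eq_bigr => e _; rewrite mulrA.
Qed.

Lemma is_peval_sum (I : Type) (s : seq I) (F : I -> n.-tuple R -> R) :
  (forall i, is_peval (F i)) -> is_peval (fun y => \sum_(i <- s) F i y).
Proof.
move=> HF; elim: s => [|i s IH].
  by have [c Hc] := is_peval0; exists c => y; rewrite big_nil Hc.
by have [c Hc] := is_pevalD _ _ (HF i) IH; exists c => y; rewrite big_cons Hc.
Qed.

Lemma is_peval_monomial (e : 'I_n -> nat) : (\sum_(i < n) e i <= t)%N ->
  is_peval (fun y => \prod_(i < n) tnth y i ^+ e i).
Proof.
move=> et; have ei i : (e i < t.+1)%N.
  by rewrite ltnS (leq_trans _ et)// (bigD1 i)//= leq_addr.
pose a0 : {ffun 'I_n -> 'I_t.+1} := [ffun i => Ordinal (ei i)].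
exists (fun a => (a == a0)%:R) => y.
rewrite /peval (bigD1 a0)/=; last first.
  by rewrite (eq_bigr (fun i => e i))// => i _; rewrite ffunE.
rewrite eqxx mul1r [X in _ + X]big1 ?addr0.
  by rewrite rmorph_prod/=; apply: eq_bigr => i _; rewrite ffunE rmorphXn.
by move=> a /andP[_ /negbTE ->]; rewrite mul0r.
Qed.

(** The power is expanded over all maps [f] from the k factors to the coordinates, which avoids
    multinomial coefficients. The fibre sizes of [f] are the exponents, and they sum to k. *)
Lemma is_peval_dotp_exp (x : n.-tuple R) k : (k <= t)%N ->
  is_peval (fun y => dotp x y ^+ k).
Proof.
move=> kt.
suff [c Hc] : is_peval (fun y => \sum_(f : {ffun 'I_k -> 'I_n})
    (\prod_(j < k) tnth x (f j)) *
    \prod_(i < n) tnth y i ^+ #|[pred j | f j == i]|).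
  exists c => y; rewrite Hc; congr rc.
  rewrite -[k in RHS]card_ord -prodr_const /dotp bigA_distr_bigA/=.
  apply: eq_bigr => f _; rewrite big_split/=; congr (_ * _).
  rewrite (partition_big f xpredT)//=; apply: eq_bigr => i _.
  rewrite (eq_bigr (fun=> tnth y i)); last by move=> j /eqP ->.
  by rewrite prodr_const; congr (_ ^+ _); apply: eq_card => j; rewrite !inE.
apply: is_peval_sum => f; apply: is_pevalZ; apply: is_peval_monomial.
rewrite (leq_trans _ kt)// -[X in (_ <= X)%N]card_ord -sum1_card.
rewrite (partition_big f xpredT)//= leq_sum// => i _.
by rewrite sum1_card; apply: eq_leq; apply: eq_card => j; rewrite !inE.
Qed.

Lemma is_peval_zonal (x : n.-tuple R) (q : {poly R}) : (size q <= t.+1)%N ->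
  is_peval (fun y => q.[dotp x y]).
Proof.
move=> sq.
suff [c Hc] : is_peval (fun y => \sum_(i < size q) q`_i * dotp x y ^+ i).
  by exists c => y; rewrite Hc horner_coef.
apply: is_peval_sum => i; apply: is_pevalZ; apply: is_peval_dotp_exp.
by rewrite -ltnS (leq_trans _ sq).
Qed.

End PolynomialEvaluation.

(** * Spherical caps and the bound on their mass *)

Lemma cos_ge_sub_sqr (R : realType) (r : R) : 0 < r -> 1 - r ^+ 2 / 2 <= cos r.
Proof.
(* The half-angle formula cos r = 1 - 2 sin(a)^2 leaves sin(a)^2 <= a^2, which follows from the mean
   value theorem and |cos| <= 1. *)
move=> r0; pose a := r / 2; have a0 : 0 < a by rewrite divr_gt0.
have -> : r = a *+ 2 by rewrite /a; field.
have [c _] : exists2 c, c \in `]0, a[%R & sin a - sin 0 = cos c * (a - 0).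
  apply: (@MVT R sin cos) => //; by apply: continuous_subspaceT; exact: continuous_sin.
rewrite sin0 !subr0 => sa.
have := cos2Dsin2 a; have := cos2Dsin2 c; have := sqr_ge0 (sin c).
rewrite cos_mulr2n sa exprMn; have := sqr_ge0 a.
by rewrite -mulr_natr; nra.
Qed.

Lemma measurable_sphere (R : realType) n : measurable (sphere R n).
Proof.
rewrite (_ : sphere R n = (fun y : n.-tuple R => dotp y y) @^-1` [set 1])//.
by rewrite -[X in measurable X]setTI; exact: measurable_dotp_diag.
Qed.

Lemma measurable_cap (R : realType) n (x : n.-tuple R) r : measurable (cap x r).
Proof.
rewrite (_ : cap x r = sphere R n `&` dotp x @^-1` `[cos r, +oo[); last first.
  by apply/seteqP; split => y /=; rewrite in_itv/= andbT.
apply: measurableI; first exact: measurable_sphere.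
by rewrite -[X in measurable X]setTI; exact: measurable_dotp.
Qed.

Theorem theorem4p1 (R : realType) (d t : nat) (nu A : R)
  (mu : {finite_measure set ((d.+1).-tuple R) -> \bar R}) :
  (1 <= d)%N -> (1 <= t)%N -> 0 < nu < 1 -> 0 < A ->
  mu (~` sphere R d.+1) = 0%E ->
  (forall c : {ffun 'I_d.+1 -> 'I_t.+1} -> complex.complex R,
     (\int[mu]_(x in sphere R d.+1) (sqmod t c x)%:E <= A%:E * L2sq t c)%E) ->
  forall r : R, 0 < r ->
  r ^+ 2 = (1 - nu) * ((d%:R + 2) / (t%:R * (t%:R + d%:R))) ->
  forall x : (d.+1).-tuple R, sphere R d.+1 x ->
  (mu (cap x r) <= (A / (nu ^+ 2 * (dimPi d t)%:R))%:E)%E.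
Proof.
move=> d1 t1 /andP[nu0 nu1] A0 _ HMZ r r0 r2 x x1.
pose p := jacobi R d t \Po (1 - 'X).
have sp : (size p <= t.+1)%N.
  rewrite /p (leq_trans (size_comp_poly_leq _ _))//.
  have -> : (size (1 - 'X : {poly R})).-1 = 1%N.
    by rewrite -opprB size_polyN size_XsubC.
  by rewrite muln1 ltnS -subn1 leq_subLR add1n size_jacobi.
have [c Hc] := is_peval_zonal R d.+1 t x p sp.
have sqm y : sqmod t c y = p.[dotp x y] ^+ 2.
  rewrite /sqmod Hc /Normc.normc /= expr0n addr0 sqrtr_sqr.
  by rewrite real_normK ?num_real.
have D0 := jacobi_dim_gt0 R d t d1.
have DE : (dimPi d t)%:R = jacobi_dim R d t by rewrite jacobi_dimE.
have L2 : (L2sq t c <= ((jacobi_dim R d t)^-1)%:E)%E.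
  have E1 : leb_int R (fun y : d.+1.-tuple R => (\1_(unit_ball R d.+1) y)%:E) =
      (zonal_int R d.+1 x 1)%:E.
    rewrite -leb_int_zonal//; last by move=> s; rewrite hornerC.
    by apply: eq_leb_int => y; rewrite hornerC mule1.
  have E2 : leb_int R (fun y : d.+1.-tuple R => ((\1_(unit_ball R d.+1) y)%:E *
      (sqmod t c (radial y))%:E)%E) = (zonal_int R d.+1 x (p ^+ 2))%:E.
    rewrite -leb_int_zonal//; last by move=> s; rewrite horner_exp sqr_ge0.
    by apply: eq_leb_int => y; rewrite sqm horner_exp.
  rewrite /L2sq /sphere_int E2 /ball_volume E1/= -EFinM lee_fin.
  (* For a zero normalizing volume the inverse is 0 by convention and so is the norm; otherwise the
     norm is exactly the inverse dimension. *)
  have [->|V0] := eqVneq (zonal_int R d.+1 x 1) 0.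
    by rewrite invr0 mulr0 invr_ge0 ltW.
  have H := zonal_int_jacobi R d.+1 x x1 d t erefl d1 V0.
  have -> : zonal_int R d.+1 x (p ^+ 2) = (jacobi_dim R d t)^-1 * zonal_int R d.+1 x 1.
    by rewrite -H mulKf// gt_eqF.
  by rewrite mulfK.
have N0 : 0 < t%:R * (t%:R + d%:R) :> R.
  by rewrite -natrD -natrM ltr0n muln_gt0 t1 addn_gt0 t1.
have d2 : 0 < d%:R + 2 :> R by rewrite ltr_wpDl.
have capE y : cap x r y -> nu <= p.[dotp x y].
  move=> [y1 ry]; set s := dotp x y in ry *.
  have s1 : s <= 1.
    have := dotp_unit_sqr_le R d.+1 x x1 y; rewrite (y1 : dotp y y = 1) -/s => ss.
    by rewrite (le_trans (ler_norm s))// -(@ler_pXn2r _ 2)// ?nnegrE// expr1n real_normK ?num_real.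
  have us : 1 - s <= r ^+ 2 / 2 by have := cos_ge_sub_sqr R r r0; lra.
  have r2N : r ^+ 2 * (t%:R * (t%:R + d%:R) / (d%:R + 2)) = 1 - nu.
    rewrite r2; field.
    by move: N0 => /lt0r_neq0; rewrite mulf_eq0 negb_or => /andP[-> ->]; rewrite gt_eqF.
  (* As r^2 times this quotient is 1 - nu, the bound 1/2 gives 1 - s <= r^2 / 2 <= 1 - nu < 1, so
     the cap lies in the range of [jacobi_lower_bound]. *)
  have c2 : 2^-1 <= t%:R * (t%:R + d%:R) / (d%:R + 2) :> R.
    rewrite ler_pdivlMr// ler_pdivrMl// -!natrD -!natrM ler_nat; nia.
  have u1 : 0 <= 1 - s <= 1.
    apply/andP; split; first by lra.
    by have := sqr_ge0 r; nra.
  (* Inserting 1 - s <= r^2 / 2 bounds p below by 1 - (1 - nu)/2 = (1 + nu)/2, which is at least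
     nu. *)
  have := jacobi_lower_bound R d t (1 - s) t1 u1.
  rewrite /p horner_comp !(hornerD, hornerN, hornerC, hornerX); apply: le_trans.
  move: r2N c2; set c' := _ / _ => r2N c2; nra.
have mq : measurable_fun setT (fun y : d.+1.-tuple R => (sqmod t c y)%:E).
  apply/measurable_EFinP; rewrite (funext sqm : sqmod t c = _).
  apply: measurable_funX.
  exact: measurableT_comp (continuous_measurable_fun (@continuous_horner _ p))
    (measurable_dotp R d.+1 x).
have mc := measurable_cap R d.+1 x r.
have ms := measurable_sphere R d.+1.
have nu2 : 0 < nu ^+ 2 by rewrite exprn_gt0.
(* Chebyshev's inequality on the cap, enlargement of the domain to the sphere, then the
   Marcinkiewicz-Zygmund inequality for the zonal test polynomial. *)
have step : ((nu ^+ 2)%:E * mu (cap x r) <= (A / jacobi_dim R d t)%:E)%E.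
  rewrite -integral_cst//.
  apply: (@le_trans _ _ (\int[mu]_(y in cap x r) (sqmod t c y)%:E)%E).
    apply: ge0_le_integral => //.
    - by move=> y _; rewrite lee_fin ltW.
    - exact: measurable_funTS.
    - move=> y cy; rewrite lee_fin sqm ler_pXn2r ?nnegrE ?(ltW nu0) ?capE//.
      exact: le_trans (ltW nu0) (capE y cy).
  apply: (@le_trans _ _ (\int[mu]_(y in sphere R d.+1) (sqmod t c y)%:E)%E).
    apply: ge0_subset_integral => //.
    - exact: measurable_funTS.
    - by move=> y _; rewrite lee_fin sqm sqr_ge0.
    - by move=> y [].
  by rewrite (le_trans (HMZ c))// EFinM lee_wpmul2l// lee_fin ltW.
have mufin : mu (cap x r) \is a fin_num by exact: fin_num_measure.
move: step; rewrite -(fineK mufin) -EFinM !lee_fin DE => step.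
by rewrite invfM mulrCA mulrC ler_pdivlMr// mulrC.
Qed.
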